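(* Let $\phi$ be a father wavelet that is of bounded $p$-variation for some $1\le p<\infty$ and vanishes on $(B_1,B_2]^c$ for some $-\infty<B_1<B_2<\infty$. Suppose that $P$ has a bounded density $p_0$, and let $j_n\nearrow\infty$ be a sequence of nonnegative integers such that $\frac{n}{j_n2^{j_n}}\to\infty$, $\frac{j_n}{\log\log n}\to\infty$ as $n\to\infty$, and $\sup_{n\ge n_0}(j_{2n}-j_n)\le\tau$ for some $\tau\ge1$ and some $n_0<\infty$. Then $$\limsup_{n\to\infty}\sqrt{\frac{n}{j_n2^{j_n}}}\,\sup_{y\in\mathbb R}\left|\frac{p_n(y)-Ep_n(y)}{\sqrt{\sum_{k\in\mathbb Z}\phi^2(2^{j_n}y-k)}}\right|=C\quad\text{almost surely},$$ where $C$ is a constant satisfying $C^2\le M^2 2^{\tau}\|p_0\|_\infty$ for a constant $M$ that depends only on $D_1$, $D_2$, $\|\Phi\|_\infty$ and on the constants $A$ and $v$ (all defined in the context).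
   Context: $X,X_1,X_2,\dots$ are i.i.d. real random variables with absolutely continuous law $P$ with density $p_0$, realized as the coordinate projections of $(\mathbb R^{\mathbb N},\mathcal B^{\mathbb N},P^{\mathbb N})$. $\|h\|_\infty=\sup_{x\in\mathbb R}|h(x)|$. A father wavelet is a function $\phi\in\mathcal L^2(\mathbb R)$ such that $\{\phi(\cdot-k):k\in\mathbb Z\}$ is an orthonormal system in $\mathcal L^2(\mathbb R)$ and the spaces $V_0=\{\sum_kc_k\phi(\cdot-k):\{c_k\}\in\ell^2\}$, $V_j=\{f(2^j\cdot):f\in V_0\}$ are nested ($V_{j-1}\subseteq V_j$ for $j\in\mathbb N$) with $\bigcup_{j\ge0}V_j$ dense in $\mathcal L^2(\mathbb R)$. A function $h:\mathbb R\to\mathbb R$ is of bounded $p$-variation if $v_p(h)=\sup\{\sum_{i=1}^n|h(x_i)-h(x_{i-1})|^p:n\in\mathbb N,\ -\infty<x_0<\dots<x_n<\infty\}<\infty$. $K(y,x)=\sum_{k\in\mathbb Z}\phi(y-k)\phi(x-k)$, and the linear wavelet density estimator is $p_n(y)=\frac1n\sum_{i=1}^n2^{j_n}K(2^{j_n}y,2^{j_n}X_i)$. $\Phi:\mathbb R\to[0,\infty)$ is a bounded, compactly supported, symmetric function (it exists) with $|K(y,x)|\le\Phi(y-x)$ for all $x,y$. $0<D_1\le D_2<\infty$ are constants (they exist) with $D_1^2\le\int K^2(y,u)\,du=\sum_k\phi^2(y-k)\le D_2^2$ for all $y\in\mathbb R$. $A,v$ are positive finite constants depending only on $\phi$ (they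 exist) such that the class $\mathcal F_\phi=\{\sum_{k\in\mathbb Z}\phi(2^jy-k)\phi(2^j(\cdot)-k):y\in\mathbb R,\ j\in\mathbb N\cup\{0\}\}$ satisfies $\sup_QN(\mathcal F_\phi,\mathcal L^2(Q),\varepsilon)\le(A/\varepsilon)^v$ for $0<\varepsilon<A$, the supremum being over all Borel probability measures $Q$ on $\mathbb R$; here $N(\mathcal F,\mathcal L^2(Q),\varepsilon)$ is the minimal number of $\mathcal L^2(Q)$-balls of radius at most $\varepsilon$ covering $\mathcal F$. *)

(* Defs.v *)
From HB Require Import structures.
From mathcomp Require Import all_boot all_order all_algebra.
From mathcomp Require Import all_classical all_reals all_analysis.

Set Implicit Arguments.
Unset Strict Implicit.
Unset Printing Implicit Defensive.

Import Order.TTheory GRing.Theory Num.Theory.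
Import numFieldNormedType.Exports.

Local Open Scope classical_set_scope.
Local Open Scope ring_scope.

(* The real-valued [sup] is only meaningful for bounded h. *)
Definition supnorm (R : realType) (h : R -> R) : R :=
  sup (range (fun x => `|h x|)).

Definition p_variation (R : realType) (p : R) (h : R -> R) : \bar R :=
  ereal_sup [set s | exists (n : nat) (x : nat -> R),
    (forall i, (i < n)%N -> x i < x i.+1) /\
    s = (\sum_(i < n) `|h (x i.+1) - h (x i)| `^ p)%:E].

Definition bounded_p_variation (R : realType) (p : R) (h : R -> R) : Prop :=
  (p_variation p h < +oo)%E.

(* L^2(mu) is [Lfun mu 2]: measurable, real-valued, square integrable functions,
   not quotiented by a.e. equality. *)
Definition L2norm d (T : measurableType d) (R : realType)
    (mu : {measure set T -> \bar R}) (f : T -> R) : \bar R :=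
  ('N[mu]_2%:E[EFin \o f])%E.

(* f = \sum_(k in Z) c_k phi(. - k), the series converging in L^2(R). The set
   is closed under a.e. equality, hence describes a space of classes. *)
Definition V0 (R : realType) (phi : R -> R) : set (R -> R) :=
  [set f | f \in Lfun (@lebesgue_measure R) 2%:E /\
    exists c : int -> R,
      (\esum_(k in [set: int]) (c k ^+ 2)%:E < +oo)%E /\
      (fun N : nat => L2norm (@lebesgue_measure R)
         (fun x => f x - \sum_(k \in [set k : int | (`|k| <= N)%N])
                            c k * phi (x - k%:~R))) @ \oo --> 0%E].

Definition V (R : realType) (phi : R -> R) (j : nat) : set (R -> R) :=
  [set (fun x => f (2 ^+ j * x)) | f in V0 phi].

Record father_wavelet (R : realType) (phi : R -> R) : Prop := FatherWavelet {
  father_L2 : phi \in Lfun (@lebesgue_measure R) 2%:E;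
  father_orthonormal : forall k l : int,
    (\int[@lebesgue_measure R]_x (phi (x - k%:~R) * phi (x - l%:~R))%:E
     = ((k == l)%:R)%:E)%E;
  father_nested : forall j, V phi j `<=` V phi j.+1;
  father_dense : forall f : R -> R, f \in Lfun (@lebesgue_measure R) 2%:E ->
    forall e : R, 0 < e -> exists j g, V phi j g /\
      (L2norm (@lebesgue_measure R) (fun x => f x - g x)%R < e%:E)%E }.

(* [\sum_(k \in [set: int])] is the sum over a finite support (0 otherwise):
   this is the sum of the series over Z when phi vanishes off a bounded set. *)
Definition wavelet_kernel (R : realType) (phi : R -> R) (y x : R) : R :=
  \sum_(k \in [set: int]) phi (y - k%:~R) * phi (x - k%:~R).

Definition sum_sq_translates (R : realType) (phi : R -> R) (y : R) : R :=
  \sum_(k \in [set: int]) phi (y - k%:~R) ^+ 2.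

Definition wavelet_class (R : realType) (phi : R -> R) : set (R -> R) :=
  [set f | exists (y : R) (j : nat),
     f = fun x => wavelet_kernel phi (2 ^+ j * y) (2 ^+ j * x)].

(* F is covered by n open L^2(Q)-balls of radius at most eps, whose centres lie
   in L^2(Q) but not necessarily in F. *)
Definition L2_covered (R : realType) (F : set (R -> R))
    (Q : probability (measurableTypeR R) R) (eps : R) (n : nat) : Prop :=
  exists (g : 'I_n -> R -> R) (r : 'I_n -> R),
    (forall i, g i \in Lfun Q 2%:E /\ r i <= eps) /\
    (forall f, F f -> exists i,
       (L2norm Q (fun x => f x - g i x)%R < (r i)%:E)%E).

(* +oo when no finite cover exists. *)
Definition covering_number (R : realType) (F : set (R -> R))
    (Q : probability (measurableTypeR R) R) (eps : R) : \bar R :=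
  ereal_inf [set (n%:R : R)%:E | n in L2_covered F Q eps].

Definition has_density (R : realType) (P : probability (measurableTypeR R) R)
    (p0 : R -> R) : Prop :=
  [/\ measurable_fun [set: R] p0, (forall x, 0 <= p0 x) &
      forall A : set (measurableTypeR R), measurable A ->
        P A = (\int[@lebesgue_measure R]_(x in A) (p0 x)%:E)%E].

(* The space R^N with the sigma-algebra B^N generated by the coordinates. *)
Definition coordinate_cylinders (R : realType) : set (set (nat -> R)) :=
  [set A | exists (i : nat) (B : set (measurableTypeR R)),
     measurable B /\ A = [set w | B (w i)]].

Definition seq_space (R : realType) :=
  g_sigma_algebraType (@coordinate_cylinders R).

(* PN is the product measure P^N, which is determined by its values on
   finite-dimensional rectangles; equivalently, under PN the coordinate
   projections are i.i.d. with law P. *)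
Definition is_product_measure (R : realType)
    (P : probability (measurableTypeR R) R)
    (PN : probability (seq_space R) R) : Prop :=
  forall (n : nat) (B : nat -> set (measurableTypeR R)),
    (forall i, measurable (B i)) ->
    PN [set w | forall i, (i < n)%N -> B i (w i)] =
      (\prod_(i < n) P (B i))%E.

(* The sample X_1, X_2, ... consists of the coordinates w 0, w 1, ... of w. *)
Definition density_estimator (R : realType) (phi : R -> R) (j : nat -> nat)
    (n : nat) (y : R) (w : seq_space R) : R :=
  n%:R^-1 * \sum_(i < n)
    2 ^+ j n * wavelet_kernel phi (2 ^+ j n * y) (2 ^+ j n * w i).

Definition normalized_deviation (R : realType) (phi : R -> R) (j : nat -> nat)
    (PN : probability (seq_space R) R) (n : nat) (w : seq_space R) : \bar R :=
  ereal_sup (range (fun y : R =>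
    `| (density_estimator phi j n y w
          - fine ('E_PN[density_estimator phi j n y])%E)
       / Num.sqrt (sum_sq_translates phi (2 ^+ j n * y)) |%:E)).

(* Main.v *)
(* Write u = 2^j y. Since phi vanishes off a bounded interval, the deviation
   p_n(y) - E p_n(y), divided by the square root of sum_k phi(u - k)^2, is 2^j / n
   times the scalar product of a unit vector of R^m with the vector of the
   centered sums of phi(2^j X_i - k), where k runs over a window of m consecutive
   integers. A finite grid in the unit ball of R^m computes the norm of such a
   vector up to a factor 2, so only countably many centered random walks matter,
   one per window and grid point. Orthonormality bounds the variance of their
   steps by 2^-j ||p0||, and the sum of these variances over all windows is
   finite. A maximal inequality that is exponential in the threshold but linear
   in the variance can thus be summed over the windows; the size of the grid
   and m affect only a constant factor of the probabilities, and not C.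
   Borel-Cantelli along the blocks 2^k <= n < 2^(k+1) gives the almost sure bound,
   and Kolmogorov's zero-one law makes the limsup constant. The resulting
   bound is C^2 <= 128 ||p0||. *)
Require Import Defs.
From HB Require Import structures.
From mathcomp Require Import all_boot all_order all_algebra.
From mathcomp Require Import all_classical all_reals all_analysis.
From mathcomp Require Import measurable_realfun.
From mathcomp Require Import zify ring lra.
Set Implicit Arguments.
Unset Strict Implicit.
Unset Printing Implicit Defensive.
Import Order.TTheory GRing.Theory Num.Theory.
Import numFieldNormedType.Exports.
Local Open Scope classical_set_scope.
Local Open Scope ring_scope.

(** * Infinite product measure *)

(** The obstacle is that y ranges over the whole line: at level J infinitely many windows may
    matter, and a union bound over them needs a summable right-hand side. The variance of a step
    therefore enters twice. For a single window it is at most [c / 2 ^ J], which controls the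
    exponential growth of the walk uniformly over the windows. Over all windows the variances add up
    to at most [m * D ^ 2], a bound that holds pointwise before integration; it sums the factor that
    is linear in the variance. With the rate l chosen so that the growth exponent
    [N * l ^ 2 * c / 2 ^ J] is J, a threshold t with [l * t = 4 * J] contributes exp (-4 J). One J
    pays for the growth, two pay for a factor [J * 2 ^ J], and the last one is summable over the
    blocks because j_n / log log n tends to infinity. This explains 128 as the square of 4 * 2 *
    sqrt 2: the 4 is that of the threshold, the 2 is lost on the grid, and sqrt 2 appears because a
    block that contains n extends up to 2 n. *)

Definition seq_cons (R : realType) (x : R) (w : seq_space R) : seq_space R :=
  fun i => if i is i'.+1 then w i' else x.

Definition rectangle (R : realType) (n : nat)
    (B : nat -> set (measurableTypeR R)) : set (seq_space R) :=
  [set w | forall i, (i < n)%N -> B i (w i)].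

Lemma measurable_coordinate (R : realType) (i : nat) :
  measurable_fun [set: seq_space R]
    (fun w : seq_space R => w i : measurableTypeR R).
Proof.
move=> _ B mB; rewrite setTI; apply: sub_sigma_algebra.
by exists i, B.
Qed.

Lemma measurable_rectangle (R : realType) n (B : nat -> set (measurableTypeR R)) :
  (forall i, measurable (B i)) -> measurable (rectangle n B).
Proof.
move=> mB.
have -> : rectangle n B =
    \bigcap_(i in [set k | (k < n)%N]) [set w : seq_space R | B i (w i)].
  by [].
apply: bigcap_measurableType => i _.
by rewrite -[X in measurable X]setTI; exact: measurable_coordinate.
Qed.

(** Rectangles generate the sigma-algebra and, once padded with [setT] to a common length, are
    stable under intersection; the one of length 0 is the whole space. *)
Lemma seq_space_measure_unique (R : realType)
    (m1 m2 : {measure set (seq_space R) -> \bar R}) :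
  (m1 setT < +oo)%E ->
  (forall n (B : nat -> set (measurableTypeR R)), (forall i, measurable (B i)) ->
     m1 (rectangle n B) = m2 (rectangle n B)) ->
  forall A : set (seq_space R), measurable A -> m1 A = m2 A.
Proof.
move=> m1oo m12.
pose G : set (set (seq_space R)) :=
  [set A | exists n (B : nat -> set (measurableTypeR R)),
    (forall i, measurable (B i)) /\ A = rectangle n B].
have rT : rectangle 0 (fun=> setT) = [set: seq_space R].
  by apply/seteqP; split.
apply: (measure_unique G (fun=> setT)).
- apply/seteqP; split.
    apply: smallest_sub; first exact: smallest_sigma_algebra.
    move=> _ [i [B [mB ->]]]; apply: sub_sigma_algebra.
    exists i.+1, (fun k => if k == i then B else setT); split.
      by move=> k; case: ifP.
    apply/seteqP; split=> [w Bw k _|w /(_ i)]; rewrite ?eqxx /=; last exact.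
    by case: eqVneq => [->|].
  apply: smallest_sub; first exact: sigma_algebra_measurable.
  by move=> _ [n [B [mB ->]]]; exact: measurable_rectangle.
- move=> _ _ [n [B [mB ->]]] [m [C [mC ->]]].
  exists (maxn n m), (fun i => (if (i < n)%N then B i else setT) `&`
                               (if (i < m)%N then C i else setT)); split.
    by move=> i; apply: measurableI; case: ifP.
  apply/seteqP; split=> [w [Bw Cw] i _|w BCw].
    by split; case: ifP => // ?; [exact: Bw|exact: Cw].
  split=> i im.
    have /BCw[] : (i < maxn n m)%N by rewrite leq_max im.
    by rewrite im.
  have /BCw[] : (i < maxn n m)%N by rewrite leq_max im orbT.
  by rewrite im.
- by move=> _; exists 0%N, (fun=> setT); rewrite rT.
- by rewrite bigcup_const.
- by move=> _ [n [B [mB ->]]]; exact: m12.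
- by [].
Qed.

Lemma measurable_seq_cons (R : realType) :
  measurable_fun [set: measurableTypeR R * seq_space R]
    (fun p => seq_cons p.1 p.2).
Proof.
apply: (@measurability _ _ _ (seq_space R) _ _ (@coordinate_cylinders R)) => //.
move=> _ [_ [i [B [mB ->]]] <-]; rewrite setTI.
case: i => [|i] /=.
  by rewrite -[X in measurable X]setTI; exact: measurable_fst.
rewrite -[X in measurable X]setTI.
exact: (measurableT_comp (@measurable_coordinate R i) measurable_snd).
Qed.

Section product.
Context (R : realType) (P : probability (measurableTypeR R) R)
  (PN : probability (seq_space R) R) (hPN : is_product_measure P PN).

(** By uniqueness on rectangles, [PN] is the image of [P \x PN] under [seq_cons]. The inductions
    below integrate out the first coordinate in this way, so that what remains is again a full
    sequence with law [PN]. *)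
Lemma product_measure_cons (A : set (seq_space R)) : measurable A ->
  PN A = (\int[P]_x PN (seq_cons x @^-1` A))%E.
Proof.
move=> mA.
pose c := (fun p : measurableTypeR R * seq_space R => seq_cons p.1 p.2).
have mc : measurable_fun setT c := @measurable_seq_cons R.
pose X : {mfun _ >-> _} := mfun_Sub (mem_set mc : c \in mfun).
pose mPN : {measure set (seq_space R) -> \bar R} := PN.
pose mD : {measure set (seq_space R) -> \bar R} :=
  distribution (P \x PN)%E X.
rewrite -/(mPN A) (@seq_space_measure_unique R mPN mD _ _ A mA).
- rewrite /mD /= /distribution /pushforward /=.
  rewrite /product_measure1 /=.
  apply: eq_integral => x _ /=; congr (PN _).
  by apply/seteqP; split=> w; rewrite /xsection /= inE.
- by rewrite -ge0_fin_numE// fin_num_measure.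
- move=> n B mB; rewrite /mPN /mD /= /distribution /pushforward /=.
  case: n => [|n].
    rewrite (_ : rectangle 0 B = setT) ?preimage_setT; last first.
      by apply/seteqP; split.
    rewrite -setXTT product_measure1E//.
    have PT : P setT = 1%E by exact: probability_setT.
    have PNT : PN setT = 1%E by exact: probability_setT.
    by rewrite [LHS]PNT [X in (X * _)%E]PT [X in (_ * X)%E]PNT mule1.
  rewrite (_ : _ @^-1` _ = B 0%N `*` rectangle n (fun i => B i.+1)).
    rewrite product_measure1E//; last exact: measurable_rectangle.
    rewrite [LHS]hPN//.
    rewrite [X in (_ * X)%E](hPN n (fun i => mB i.+1)).
    by rewrite big_ord_recl.
  apply/seteqP; split=> [[x w] h|[x w] [/= h0 h] [|i] //]; last exact: h.
  by split; [exact: (h 0%N)|move=> i ni; exact: (h i.+1)].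
Qed.

Lemma measurable_product_section (A : set (seq_space R)) : measurable A ->
  measurable_fun [set: measurableTypeR R]
    (fun x : measurableTypeR R => PN (seq_cons x @^-1` A)).
Proof.
move=> mA.
pose c := (fun p : measurableTypeR R * seq_space R => seq_cons p.1 p.2).
have mcA : measurable (c @^-1` A).
  by rewrite -[X in measurable X]setTI; exact: measurable_seq_cons.
have := measurable_fun_xsection PN mcA.
apply: eq_measurable_fun => x _ /=; congr (PN _).
by apply/seteqP; split=> w; rewrite /xsection /= inE.
Qed.

Lemma measurable_seq_cons_section (x : R) (A : set (seq_space R)) :
  measurable A -> measurable (seq_cons x @^-1` A).
Proof.
move=> mA; rewrite -[X in measurable X]setTI.
apply: (@measurability _ _ _ (seq_space R) _ _ (@coordinate_cylinders R)) => //.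
move=> _ [_ [i [B [mB ->]]] <-]; rewrite setTI.
case: i => [|i] /=.
  have [Bx|Bx] := pselect (B x).
    by rewrite [X in measurable X](_ : _ = setT)//; apply/seteqP; split.
  by rewrite [X in measurable X](_ : _ = set0)//; apply/seteqP; split.
by rewrite -[X in measurable X]setTI; exact: measurable_coordinate.
Qed.

End product.

(** * Zero-one law *)

Definition eventually_eq (T : Type) (w w' : nat -> T) :=
  exists n, forall i, (n <= i)%N -> w i = w' i.

(** Among measurable sets these are the members of the tail sigma-algebra: a set that ignores the
    first n coordinates is determined by the others. In this form the property visibly passes to
    sections along [seq_cons]. *)
Definition tail_event (R : realType) (F : set (seq_space R)) :=
  forall w w' : seq_space R, eventually_eq w w' -> F w -> F w'.

Section zero_one.
Context (R : realType) (P : probability (measurableTypeR R) R)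
  (PN : probability (seq_space R) R) (hPN : is_product_measure P PN).

Lemma tail_event_cons (F : set (seq_space R)) (x y : R) :
  tail_event F -> seq_cons x @^-1` F = seq_cons y @^-1` F.
Proof.
by move=> tF; apply/seteqP; split=> w /=; apply: tF; exists 1%N => -[].
Qed.

Lemma tail_event_preimage_cons (F : set (seq_space R)) (x : R) :
  tail_event F -> tail_event (seq_cons x @^-1` F).
Proof.
move=> tF w w' [n nw]; apply: tF; exists n.+1 => -[|i]//= ni.
exact: nw.
Qed.

Lemma product_measure_tail_cons (F : set (seq_space R)) (x : R) :
  measurable F -> tail_event F -> PN (seq_cons x @^-1` F) = PN F.
Proof.
move=> mF tF; rewrite [RHS](product_measure_cons hPN mF).
under eq_integral do rewrite (tail_event_cons _ x tF).
have PT : P setT = 1%E by exact: probability_setT.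
by rewrite integral_cst// [X in (_ * X)%E]PT mule1.
Qed.

(** All sections of a tail event at the first coordinate coincide; the common section is again a
    tail event, of the same probability. So one factor of the rectangle can be split off at a
    time. *)
Lemma tail_event_indep n (B : nat -> set (measurableTypeR R))
    (F : set (seq_space R)) :
  (forall i, measurable (B i)) -> measurable F -> tail_event F ->
  PN (rectangle n B `&` F) = (PN (rectangle n B) * PN F)%E.
Proof.
elim: n B F => [|n IH] B F mB mF tF.
  have -> : rectangle 0 B = setT by apply/seteqP; split.
  have PNT : PN setT = 1%E by exact: probability_setT.
  by rewrite setTI [X in (X * _)%E]PNT mul1e.
have mR := measurable_rectangle n.+1 mB.
rewrite (product_measure_cons hPN); last exact: measurableI.
pose F0 := seq_cons 0 @^-1` F.
have mF0 : measurable F0 by exact: measurable_seq_cons_section.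
have tF0 : tail_event F0 by exact: tail_event_preimage_cons.
pose c := PN (rectangle n (fun i => B i.+1) `&` F0).
transitivity (\int[P]_(x in B 0%N) c)%E.
  rewrite [RHS]integral_mkcond; apply: eq_integral => x _ /=.
  rewrite patchE; case: ifPn => [/set_mem Bx|/negP Bx].
    congr (PN _); rewrite /F0 (tail_event_cons 0 x tF).
    apply/seteqP; split=> w /= [h Fw]; split=> //.
      by move=> i ni; exact: (h i.+1).
    by move=> [|i] ni//=; exact: h.
  rewrite -[RHS](measure0 PN); congr (PN _).
  apply/seteqP; split=> w //= -[/(_ 0%N isT) Bx0 _].
  by apply: Bx; rewrite inE.
rewrite integral_cst// /c IH//.
rewrite [X in (_ * X * _)%E](@product_measure_tail_cons F)//.
rewrite [in RHS](hPN n.+1 mB) big_ord_recl.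
rewrite [X in (X * _ * _)%E](hPN n (fun i => mB i.+1)).
by rewrite muleC muleA.
Qed.

(** Restricting [PN] to [F] and multiplying [PN] by the number [PN F] give the same values on
    rectangles, hence on [F] itself, where they read [PN F] and its square. *)
Lemma zero_one_law (F : set (seq_space R)) :
  measurable F -> tail_event F -> PN F = 0%E \/ PN F = 1%E.
Proof.
move=> mF tF.
have PNfin A : measurable A -> PN A \is a fin_num by exact: fin_num_measure.
have r0 : 0 <= fine (PN F) by rewrite fine_ge0.
pose m1 : {measure set (seq_space R) -> \bar R} := mrestr PN mF.
pose m2 : {measure set (seq_space R) -> \bar R} := mscale (NngNum r0) PN.
have m12 : m1 F = m2 F.
  apply: seq_space_measure_unique => //.
    have -> : m1 setT = PN F.
      by rewrite /m1 /= /mrestr /=; congr (PN _); exact: setTI.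
    by rewrite -ge0_fin_numE ?PNfin.
  move=> n B mB; rewrite /m1 /m2 /mrestr /mscale /=.
  transitivity (PN (rectangle n B) * PN F)%E; first exact: tail_event_indep.
  transitivity ((fine (PN F))%:E * PN (rectangle n B))%E; last by [].
  by rewrite fineK ?PNfin// muleC.
have : PN F = ((fine (PN F))%:E * PN F)%E.
  by rewrite -[LHS](congr1 PN (setIid F)); exact: m12.
rewrite -(fineK (PNfin _ mF)) /=; set r := fine _.
rewrite -EFinM => -[/eqP]; rewrite -subr_eq0 -{1}(mulr1 r) -mulrBr mulf_eq0.
by move=> /orP[/eqP ->|]; [left|rewrite subr_eq0 => /eqP <-; right].
Qed.

(** The distribution function of [L] takes only the values 0 and 1, so it jumps at a single level,
    the infimum of those with value 1. The bounds 0 and [C0] make this infimum finite. *)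
Lemma tail_function_ae_cst (L : seq_space R -> \bar R) (C0 : R) :
  measurable_fun setT L ->
  (forall w w' : seq_space R, eventually_eq w w' -> L w = L w') ->
  (forall w, (0 <= L w)%E) -> {ae PN, forall w, (L w <= C0%:E)%E} ->
  exists2 C : R, 0 <= C <= C0 & {ae PN, forall w, L w = C%:E}.
Proof.
move=> mL tL L0 LC0.
pose F (c : R) := [set w | (L w <= c%:E)%E].
have mF c : measurable (F c).
  rewrite (_ : F c = L @^-1` [set` `]-oo, c%:E]]); last first.
    by apply/seteqP; split=> w; rewrite /F /= in_itv.
  by rewrite -[X in measurable X]setTI; apply: mL => //; exact: emeasurable_itv.
have tF c : tail_event (F c) by move=> w w' ww'; rewrite /F /= (tL _ _ ww').
have subF c d : c <= d -> F c `<=` F d.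
  by move=> cd w /le_trans; apply; rewrite lee_fin.
pose S := [set c | PN (F c) = 1%E].
have SC0 : S C0.
  have [A [mA A0 FA]] := LC0.
  rewrite /S /= -[F C0]setCK probability_setC; last exact: measurableC.
  rewrite (_ : PN (~` F C0) = 0%E) ?sube0//.
  apply/eqP; rewrite -measure_le0 -A0 le_measure ?inE//.
  exact: measurableC.
have lS : lbound S 0.
  move=> c; apply: contraPP => /negP; rewrite -ltNge => c0.
  rewrite /S /= (_ : F c = set0) ?measure0.
    by move=> /eqP; rewrite eq_sym onee_eq0.
  apply/seteqP; split=> w //=; rewrite /F /= leNgt => /negP; apply.
  by rewrite (lt_le_trans _ (L0 w))// lte_fin.
have hS : has_inf S by split; [exists C0|exists 0].
have S_lt c : inf S < c -> PN (F c) = 1%E.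
  move=> /(inf_lt hS.1)[d Sd dc]; apply/eqP; rewrite eq_le probability_le1//=.
  by rewrite -Sd le_measure ?inE//; exact/subF/ltW.
have lt_S c : c < inf S -> PN (F c) = 0%E.
  move=> cS; have [//|Sc] := zero_one_law (mF c) (@tF c).
  by have := ge_inf hS.2 Sc; rewrite leNgt cS.
exists (inf S).
  by rewrite lb_le_inf//= ?ge_inf//; [exact: hS.2|exists C0].
(* Outside this countable union of null sets, [L w] is within [n.+1%:R^-1] of [inf S] for every
   [n]. *)
pose N := (\bigcup_n ~` F (inf S + n.+1%:R^-1)) `|`
          (\bigcup_n F (inf S - n.+1%:R^-1)).
suff : PN.-negligible N.
  apply: negligibleS.
  move=> w /= Lw; apply: contrapT => /not_orP[h1 h2]; apply: Lw.
  apply/eqP; rewrite eq_le; apply/andP; split.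
    apply/lee_addgt0Pr => e e0.
    have [n ne] := ltr_add_invr (e0); rewrite add0r in ne.
    apply: contrapT => h; apply: h1; exists n => //= Fw; apply: h.
    apply: le_trans Fw _; rewrite lee_fin lerD2l; exact: ltW.
  apply/lee_subgt0Pr => e e0.
  have [n ne] := ltr_add_invr (e0); rewrite add0r in ne.
  apply: contrapT => h; apply: h2; exists n => //=.
  move/negP: h; rewrite -ltNge => /ltW; rewrite /F /= => /le_trans; apply.
  by rewrite lee_fin lerD2l lerN2 ltW.
apply: negligibleU; apply: negligible_bigcup => n.
  apply/negligibleP; first exact: measurableC.
  transitivity (1 - PN (F (inf S + n.+1%:R^-1)%R))%E.
    exact: probability_setC.
  by rewrite S_lt ?subee// ltrDl.
apply/negligibleP => //.
by apply: lt_S; rewrite ltrBlDr ltrDl.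
Qed.

End zero_one.

(** * Bounded random variables *)

(** Inverting [expR (- z) >= (1 - z / 2) ^ 2] leaves [(1 + z + z ^ 2) (1 - z / 2) ^ 2 = 1 + z ^ 2 (1
    - 3 z + z ^ 2) / 4], which is at least 1 as soon as [3 z <= 1]. *)
Lemma expR_le_quadratic (R : realType) (z : R) : `|z| <= 3^-1 ->
  expR z <= 1 + z + z ^+ 2.
Proof.
rewrite ler_norml => /andP[z1 z2].
have h : (1 - z / 2) ^+ 2 <= expR (- z).
  have -> : - z = - (z / 2) + - (z / 2) by lra.
  rewrite expRD expr2; have := expR_ge1Dx (- (z / 2)).
  by move=> h; apply: ler_pM => //; lra.
have q0 : 0 <= 1 + z + z ^+ 2 by nra.
have -> : expR z = (expR (- z))^-1 by rewrite expRN invrK.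
have p0 := expR_gt0 (- z).
rewrite -[leLHS]mul1r ler_pdivrMr//.
apply: (le_trans _ (ler_wpM2l q0 h)).
by nra.
Qed.

Section bounded_measurable.
Context d (T : measurableType d) (R : realType) (P : probability T R).

(** Such functions are integrable for a probability and closed under sums, products and [expR],
    which settles the side conditions of the moment computations. *)
Definition bounded_measurable (f : T -> R) :=
  measurable_fun setT f /\ exists b, forall x, `|f x| <= b.

Lemma bounded_measurable_integrable (f : T -> R) :
  bounded_measurable f -> P.-integrable setT (EFin \o f).
Proof.
move=> [mf [b fb]]; apply: measurable_bounded_integrable => //.
  by rewrite -ge0_fin_numE// fin_num_measure.
exists b; split; first exact: num_real.
by move=> y ry x _; exact: le_trans (fb x) (ltW ry).
Qed.

Lemma bounded_measurable_cst c : bounded_measurable (cst c).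
Proof. by split; [exact: measurable_cst|exists `|c|]. Qed.

Lemma bounded_measurableD f g : bounded_measurable f -> bounded_measurable g ->
  bounded_measurable (fun x => f x + g x).
Proof.
move=> [mf [b fb]] [mg [c gc]]; split; first exact: measurable_funD.
by exists (b + c) => x; rewrite (le_trans (ler_normD _ _))// lerD.
Qed.

Lemma bounded_measurableM f g : bounded_measurable f -> bounded_measurable g ->
  bounded_measurable (fun x => f x * g x).
Proof.
move=> [mf [b fb]] [mg [c gc]]; split; first exact: measurable_funM.
by exists (b * c) => x; rewrite normrM ler_pM.
Qed.

Lemma bounded_measurableZ c f : bounded_measurable f ->
  bounded_measurable (fun x => c * f x).
Proof. exact/bounded_measurableM/bounded_measurable_cst. Qed.

Lemma bounded_measurableB f g : bounded_measurable f -> bounded_measurable g ->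
  bounded_measurable (fun x => f x - g x).
Proof.
move=> bf [mg [c gc]]; apply: bounded_measurableD => //.
by split; [exact: measurable_funN|exists c => x; rewrite normrN].
Qed.

Lemma bounded_measurable_sum (I : Type) (s : seq I) (f : I -> T -> R) :
  (forall i, bounded_measurable (f i)) ->
  bounded_measurable (fun x => \sum_(i <- s) f i x).
Proof.
move=> bf; elim: s => [|i s IH].
  by under eq_fun do rewrite big_nil; exact: bounded_measurable_cst.
by under eq_fun do rewrite big_cons; exact: bounded_measurableD.
Qed.

Lemma bounded_measurable_expR f : bounded_measurable f ->
  bounded_measurable (fun x => expR (f x)).
Proof.
move=> [mf [b fb]]; split; first exact: measurableT_comp.
exists (expR b) => x; rewrite ger0_norm ?expR_ge0// ler_expR.
exact: le_trans (ler_norm _) (fb x).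
Qed.

Lemma expect_cst c : \int[P]_x c = c.
Proof.
rewrite Rintegral_cst// -[RHS]mulr1; congr (_ * _).
exact: (congr1 fine (probability_setT P)).
Qed.

Lemma expectB_mean f : bounded_measurable f ->
  \int[P]_x (f x - \int[P]_y f y) = 0.
Proof.
move=> bf; rewrite RintegralB ?expect_cst ?subrr//.
  exact: bounded_measurable_integrable.
exact/bounded_measurable_integrable/bounded_measurable_cst.
Qed.

Lemma expect_le f g : bounded_measurable f -> bounded_measurable g ->
  (forall x, f x <= g x) -> \int[P]_x f x <= \int[P]_x g x.
Proof.
by move=> bf bg fg; apply: le_Rintegral => //;
  exact: bounded_measurable_integrable.
Qed.

Lemma expect_EFin f : bounded_measurable f ->
  (\int[P]_x (f x)%:E)%E = (\int[P]_x f x)%:E.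
Proof.
move=> /bounded_measurable_integrable bf; rewrite /Rintegral fineK//.
exact: integrable_fin_num.
Qed.

Lemma expect_sqr_centered f : bounded_measurable f ->
  \int[P]_x ((f x - \int[P]_y f y) ^+ 2) <= \int[P]_x (f x ^+ 2).
Proof.
move=> bf; set m := \int[P]_y f y.
have bff : bounded_measurable (fun x => f x ^+ 2).
  by under eq_fun do rewrite expr2; exact: bounded_measurableM.
have i1 := bounded_measurable_integrable bff.
have i2 := bounded_measurable_integrable (bounded_measurableZ (2 * m) bf).
have i3 := bounded_measurable_integrable (bounded_measurable_cst (m ^+ 2)).
have i4 := bounded_measurable_integrable
  (bounded_measurableB (bounded_measurableZ (2 * m) bf)
    (bounded_measurable_cst (m ^+ 2))).
have -> : \int[P]_x ((f x - m) ^+ 2) =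
    \int[P]_x (f x ^+ 2 - (2 * m * f x - m ^+ 2)).
  by apply: eq_Rintegral => x _; ring.
rewrite RintegralB// RintegralB// RintegralZl//; last first.
  exact: bounded_measurable_integrable.
rewrite expect_cst -/m lerBlDr lerDl.
by have := sqr_ge0 m; rewrite !expr2 => ?; lra.
Qed.

(** The zero mean removes the linear term from [1 + x <= expR x <= 1 + x + x ^ 2]. The lower bound
    is what later makes the exponential of the walk grow in mean. *)
Lemma mgf_bounds (Y : T -> R) (l b v : R) :
  bounded_measurable Y -> (forall x, `|Y x| <= b) -> 0 <= l -> l * b <= 3^-1 ->
  \int[P]_x Y x = 0 -> \int[P]_x (Y x ^+ 2) <= v ->
  1 <= \int[P]_x expR (l * Y x) <= expR (l ^+ 2 * v).
Proof.
move=> bY Yb l0 lb Y0 Yv.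
have lY0 : \int[P]_x (l * Y x) = 0.
  by rewrite RintegralZl ?Y0 ?mulr0//; exact: bounded_measurable_integrable.
have bl := bounded_measurableZ l bY.
have be := bounded_measurable_expR bl.
have b1 := bounded_measurableD (bounded_measurable_cst 1) bl.
have I1 : \int[P]_x (1 + l * Y x) = 1.
  rewrite RintegralD// ?lY0 ?addr0 ?expect_cst//.
    exact/bounded_measurable_integrable/bounded_measurable_cst.
  exact/bounded_measurable_integrable.
have bYY : bounded_measurable (fun x => Y x ^+ 2).
  by under eq_fun do rewrite expr2; exact: bounded_measurableM.
have b2 := bounded_measurableZ (l ^+ 2) bYY.
apply/andP; split.
  by rewrite -[leLHS]I1 expect_le// => x; exact: expR_ge1Dx.
apply: (@le_trans _ _ (\int[P]_x (1 + l * Y x + l ^+ 2 * Y x ^+ 2))).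
  rewrite expect_le//; first exact: bounded_measurableD b1 b2.
  move=> x; rewrite -exprMn expR_le_quadratic// normrM (ger0_norm l0).
  by apply: le_trans lb; rewrite ler_wpM2l.
rewrite RintegralD//; [|exact/bounded_measurable_integrable..].
rewrite I1 RintegralZl//; last exact: bounded_measurable_integrable.
apply: (@le_trans _ _ (1 + l ^+ 2 * v)); last exact: expR_ge1Dx.
by rewrite lerD2l ler_wpM2l ?sqr_ge0.
Qed.

End bounded_measurable.

(** * Maximal inequality *)

Definition walk (R : realType) (Y : R -> R) (n : nat) (w : seq_space R) : R :=
  \sum_(i < n) Y (w i).

(** The starting point [s] is a parameter because conditioning on the first step turns it into
    [s + Y x]. Time 0 counts, so the event is certain when [t < s]. *)
Definition walk_exceeds (R : realType) (Y : R -> R) (N : nat) (s t : R) :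
    set (seq_space R) :=
  [set w | exists2 n, (n <= N)%N & t < s + walk Y n w].

Lemma measurable_walk (R : realType) (Y : R -> R) n :
  measurable_fun [set: measurableTypeR R] Y ->
  measurable_fun [set: seq_space R] (walk Y n).
Proof.
move=> mY; apply: measurable_sum => i.
exact: measurableT_comp mY (@measurable_coordinate R i).
Qed.

Lemma measurable_walk_exceeds (R : realType) (Y : R -> R) N s t :
  measurable_fun [set: measurableTypeR R] Y ->
  measurable (walk_exceeds Y N s t).
Proof.
move=> mY.
rewrite (_ : walk_exceeds Y N s t =
    \bigcup_(n in [set k | (k <= N)%N]) [set w | t < s + walk Y n w]); last first.
  by apply/seteqP; split=> w [n nN tn]; exists n.
apply: bigcup_measurable => n _.
rewrite (_ : [set _ | _] =
    (fun w => s + walk Y n w) @^-1` [set` `]t, +oo[]); last first.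
  by apply/seteqP; split=> w; rewrite /= in_itv /= andbT.
rewrite -[X in measurable X]setTI.
have mW : measurable_fun [set: seq_space R] (fun w => s + walk Y n w).
  by apply: measurable_funD => //; exact: measurable_walk.
exact: mW.
Qed.

Lemma walk_exceeds_cons (R : realType) (Y : R -> R) N s t x : s <= t ->
  seq_cons x @^-1` walk_exceeds Y N.+1 s t = walk_exceeds Y N (s + Y x) t.
Proof.
move=> st; apply/seteqP; split=> w /= [n].
  case: n => [|n] nN; rewrite /walk ?big_ord0 ?addr0.
    by rewrite ltNge st.
  by rewrite big_ord_recl /= addrA => tn; exists n.
by move=> nN tn; exists n.+1 => //; rewrite /walk big_ord_recl /= addrA.
Qed.

Section expm1x.
Context (R : realType).
Implicit Types z : R.

Let psi z := expR z - 1 - z.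

Lemma expm1x_ge0 z : 0 <= psi z.
Proof. by rewrite /psi; have := expR_ge1Dx z; lra. Qed.

Lemma expm1x_le z z' : 0 <= z -> z <= z' -> psi z <= psi z'.
Proof.
rewrite /psi => z0 zz'; have -> : z' = z + (z' - z) by ring.
rewrite expRD; have := expR_ge1Dx (z' - z); have := expR_ge1Dx z.
by move=> h1 h2; nra.
Qed.

(** The fourth power of [1 + z / 4 <= expR (z / 4)] suffices, since [(1 + z / 4) ^ 4 >= 2 (1 + z)]
    from [z = 4] on. *)
Lemma expm1x_ge_half z : 4 <= z -> expR z / 2 <= psi z.
Proof.
move=> z4; rewrite /psi; have h := expR_ge1Dx (z / 4).
have e : expR z = expR (z / 4) ^+ 4.
  by rewrite -expRM_natl; congr expR; field.
have : (1 + z / 4) ^+ 4 <= expR z by rewrite e lerXn2r ?nnegrE//; lra.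
by nra.
Qed.

End expm1x.

Section maximal_inequality.
Context (R : realType) (P : probability (measurableTypeR R) R)
  (PN : probability (seq_space R) R) (hPN : is_product_measure P PN).
Variables (Y : R -> R) (l mu : R).
Hypotheses (bY : @bounded_measurable _ (measurableTypeR R) R Y)
  (EY0 : \int[P]_x Y x = 0) (l0 : 0 < l)
  (EeY : \int[P]_x expR (l * Y x) = mu) (mu1 : 1 <= mu).

(* [H N s] is the expectation of [psi (l * (s + walk Y N))] for the convex
   function [psi z = expR z - 1 - z]; subtracting the affine part of the
   exponential makes the bound small when [Y] itself is small. *)
Let H N s := expR (l * s) * mu ^+ N - 1 - l * s.

Let H_step N s : \int[P]_x H N (s + Y x) = H N.+1 s.
Proof.
have bl := bounded_measurableZ l bY.
have be := bounded_measurable_expR bl.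
transitivity (\int[P]_x (expR (l * s) * mu ^+ N * expR (l * Y x) -
                         ((1 + l * s) + l * Y x))).
  by apply: eq_Rintegral => x _; rewrite /H mulrDr expRD; ring.
rewrite RintegralB//.
- rewrite RintegralZl//; last exact: bounded_measurable_integrable.
  rewrite RintegralD//; last 2 first.
    exact/bounded_measurable_integrable/bounded_measurable_cst.
    exact/bounded_measurable_integrable.
  rewrite expect_cst RintegralZl//; last exact: bounded_measurable_integrable.
  by rewrite EY0 EeY /H exprSr; ring.
- exact/bounded_measurable_integrable/bounded_measurableZ.
- apply/bounded_measurable_integrable/bounded_measurableD => //.
  exact: bounded_measurable_cst.
Qed.

Let H_ge N s : expR (l * s) - 1 - l * s <= H N s.
Proof. by rewrite /H !lerB// ler_peMr ?expR_ge0// exprn_ege1. Qed.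

Let bH N s : @bounded_measurable _ (measurableTypeR R) R (fun x => H N (s + Y x)).
Proof.
have bsY : @bounded_measurable _ (measurableTypeR R) R (fun x => s + Y x).
  by apply: bounded_measurableD => //; exact: bounded_measurable_cst.
have bl := bounded_measurableZ l bsY.
apply: bounded_measurableB => //; apply: bounded_measurableB => //; last first.
  exact: bounded_measurable_cst.
apply: bounded_measurableM; first exact: bounded_measurable_expR.
exact: bounded_measurable_cst.
Qed.

(** Doob's inequality for the submartingale [psi (l * (s + walk Y n))], by induction on the number
    of steps with [s] free. If [s] is already above [t], monotonicity of [psi] and a probability at
    most 1 suffice; otherwise the first step is integrated out and [H_step] reassembles the
    bounds. *)
Lemma maximal_inequality N s t : 0 <= t ->
  ((expR (l * t) - 1 - l * t)%:E * PN (walk_exceeds Y N s t) <= (H N s)%:E)%E.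
Proof.
move=> t0; have mY := bY.1.
have p0 := expm1x_ge0 (l * t).
elim: N s => [|N IH] s.
all: have [ts|st] := ltP t s.
all: try (apply: (@le_trans _ _ (expR (l * t) - 1 - l * t)%:E);
  [rewrite -[leRHS]mule1 lee_wpmul2l ?lee_fin//; apply: probability_le1;
   exact: measurable_walk_exceeds
  |rewrite lee_fin; apply: le_trans (H_ge _ _); apply: expm1x_le;
   [by rewrite mulr_ge0// ltW|by rewrite ler_pM2l// ltW]]).
  have -> : walk_exceeds Y 0 s t = set0.
    apply/seteqP; split=> w //= [n]; rewrite leqn0 => /eqP ->.
    by rewrite /walk big_ord0 addr0 ltNge st.
  rewrite measure0 mule0 lee_fin; apply: le_trans (H_ge _ _).
  exact: expm1x_ge0.
have mE := measurable_walk_exceeds N.+1 s t mY.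
rewrite (product_measure_cons hPN mE).
rewrite -ge0_integralZl//; last exact: measurable_product_section.
rewrite -H_step -expect_EFin//.
apply: ge0_le_integral => //.
- by move=> x _; rewrite mule_ge0.
- by apply: measurable_funeM; exact: measurable_product_section.
- by apply/measurable_EFinP; have [] := bH N s.
- by move=> x _; rewrite walk_exceeds_cons.
Qed.

End maximal_inequality.

(* Unlike Bernstein's inequality, the bound is linear in the variance [v], so
   it can be summed over infinitely many walks. *)
Lemma walk_tail_bound (R : realType) (P : probability (measurableTypeR R) R)
    (PN : probability (seq_space R) R) (Y : R -> R) (b l v t : R) N :
  is_product_measure P PN ->
  @bounded_measurable _ (measurableTypeR R) R Y -> (forall x, `|Y x| <= b) ->
  \int[P]_x Y x = 0 -> \int[P]_x (Y x ^+ 2) <= v ->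
  0 < l -> l * b <= 3^-1 -> 4 <= l * t ->
  (PN (walk_exceeds Y N 0 t) <=
     (2 * expR (- (l * t)) *
      (N%:R * l ^+ 2 * v * expR (N%:R * l ^+ 2 * v)))%:E)%E.
Proof.
move=> hPN bY Yb Y0 Yv l0 lb lt4.
have t0 : 0 <= t by rewrite -(pmulr_rge0 _ l0); lra.
have /andP[mu1 muv] := mgf_bounds bY Yb (ltW l0) lb Y0 Yv.
set mu := \int[P]_x expR (l * Y x) in mu1 muv.
have := maximal_inequality hPN bY Y0 l0 erefl mu1 N 0 t0.
rewrite mulr0 expR0 mul1r subr0 -/mu.
have mE := measurable_walk_exceeds N 0 t bY.1.
rewrite -(fineK (fin_num_measure PN _ mE)) -EFinM !lee_fin.
set p := fine _; set z := N%:R * l ^+ 2 * v.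
have p0 : 0 <= p by rewrite fine_ge0.
have muz : mu ^+ N <= expR z.
  rewrite /z -mulrA expRM_natl lerXn2r ?nnegrE ?expR_ge0//.
  exact: le_trans mu1.
(* The maximal inequality started at 0 leaves [mu ^+ N - 1], at most [expR z - 1]; this estimate
   turns it into a quantity with a factor linear in [v]. *)
have ez : expR z - 1 <= z * expR z.
  have : (1 + - z) * expR z <= expR (- z) * expR z.
    by rewrite ler_wpM2r ?expR_ge0 ?expR_ge1Dx.
  by rewrite -expRD addNr expR0; lra.
have := expm1x_ge_half lt4.
have e0 := expR_gt0 (l * t).
have -> : expR (- (l * t)) = (expR (l * t))^-1 by rewrite expRN.
move=> h1 h2.
have h3 : expR (l * t) / 2 * p <= z * expR z.
  by apply: le_trans (ler_wpM2r p0 h1) _; lra.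
rewrite -(ler_pM2l e0).
have -> : expR (l * t) * (2 * (expR (l * t))^-1 * (z * expR z)) =
  2 * (z * expR z) by field; exact: lt0r_neq0.
by lra.
Qed.

(** * Scaling and densities *)

(** The image of Lebesgue measure under multiplication by [s], multiplied by [s], gives intervals
    their length. *)
Lemma lebesgue_measure_scale (R : realType) (s : R) (A : set (measurableTypeR R)) :
  0 < s -> measurable A ->
  lebesgue_measure (( *%R s) @^-1` A) = ((s^-1)%:E * lebesgue_measure A)%E.
Proof.
move=> s0 mA.
have ms : measurable_fun [set: measurableTypeR R]
    ( *%R s : measurableTypeR R -> measurableTypeR R) by exact: measurable_funM.
have s0' : 0 <= s by exact: ltW.
pose m2 : {measure set (measurableTypeR R) -> \bar R} :=
  mscale (NngNum s0')
    (measure_function_pushforward__canonical__measure_function_Measure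
       lebesgue_measure ms).
have -> : lebesgue_measure A = m2 A.
  apply: lebesgue_measure_unique => // _ [[a b]] _ <-.
  transitivity (s%:E * lebesgue_measure
      (`](a / s)%R, (b / s)%R]%classic : set R))%E;
    last first.
    congr (_ * lebesgue_measure _)%E; apply/seteqP; split=> x /=;
      by rewrite !in_itv /= ltr_pdivrMr// ler_pdivlMr// mulrC.
  rewrite !lebesgue_measure_itv /= !lte_fin ltr_pM2r ?invr_gt0//.
  case: ifPn => _; rewrite ?mule0// -!EFinB -EFinM; congr EFin.
  by field; exact: lt0r_neq0.
by rewrite /m2 /mscale /= muleA -EFinM mulVf ?lt0r_neq0// mul1e.
Qed.

(** The image of [P] under multiplication by [s] is dominated by [c / s] times Lebesgue measure.
    With [s = 2 ^ J] this is the source of the small variance. *)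
Lemma density_scaled_integral_le (R : realType)
    (P : probability (measurableTypeR R) R) (p0 : R -> R) (c s : R) (f : R -> R) :
  has_density P p0 -> (forall x, p0 x <= c) -> 0 < s ->
  measurable_fun [set: measurableTypeR R] f -> (forall x, 0 <= f x) ->
  (\int[P]_x (f (s * x)%R)%:E <=
     (c / s)%:E * \int[lebesgue_measure]_x (f x)%:E)%E.
Proof.
move=> [mp0 p00 dP] p0c s0 mf f0.
have c0 : 0 <= c by exact: le_trans (p00 0) (p0c 0).
have cs0 : 0 <= c / s by rewrite divr_ge0// ltW.
have ms : measurable_fun [set: measurableTypeR R]
    ( *%R s : measurableTypeR R -> measurableTypeR R) by exact: measurable_funM.
have mEf : measurable_fun [set: measurableTypeR R] (EFin \o f).
  exact/measurable_EFinP.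
rewrite (_ : (\int[P]_x _)%E = (\int[pushforward P
    ( *%R s : measurableTypeR R -> measurableTypeR R)]_x (f x)%:E)%E); last first.
  by rewrite ge0_integral_pushforward// => x _; exact: f0.
rewrite -[X in (X * _)%E]/((NngNum cs0)%:num%:E) -ge0_integral_mscale//; last first.
  by move=> x _; rewrite ?lee_fin; exact: f0.
apply: ge0_le_measure_integral => //.
move=> A mA; rewrite /pushforward /mscale /=.
have msA : measurable (( *%R s) @^-1` A : set (measurableTypeR R)).
  by rewrite -[X in measurable X]setTI; exact: ms.
rewrite [leLHS](dP _ msA) -[X in (_ <= X * _)%E]/((c / s)%:E) EFinM -muleA.
rewrite -lebesgue_measure_scale//.
rewrite -[leRHS]integral_cst//.
apply: ge0_le_integral => //.
- by move=> x _; exact: p00.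
- by apply/measurable_EFinP; exact: measurable_funTS.
- by move=> x _; exact: p0c.
Qed.

(** * Windows of translates of the wavelet *)

(** Lagrange's identity: the difference of the two sides is half a double sum of squares. *)
Lemma sum_cauchy_schwarz (R : realFieldType) (I : finType) (a b : I -> R) :
  (\sum_i a i * b i) ^+ 2 <= (\sum_i a i ^+ 2) * (\sum_i b i ^+ 2).
Proof.
rewrite -subr_ge0.
have -> : (\sum_i a i ^+ 2) * (\sum_i b i ^+ 2) - (\sum_i a i * b i) ^+ 2 =
    2^-1 * \sum_i \sum_j (a i * b j - a j * b i) ^+ 2.
  have -> : \sum_i \sum_j (a i * b j - a j * b i) ^+ 2 =
      \sum_i \sum_j (a i ^+ 2 * b j ^+ 2) + \sum_i \sum_j (b i ^+ 2 * a j ^+ 2)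
      - 2 * \sum_i \sum_j ((a i * b i) * (a j * b j)).
    rewrite mulr_sumr -sumrN -!big_split /=; apply: eq_bigr => i _.
    by rewrite mulr_sumr -sumrN -!big_split /=; apply: eq_bigr => j _; ring.
  by rewrite -!big_distrlr /=; field.
by rewrite mulr_ge0// sumr_ge0// => i _; rewrite sumr_ge0// => j _; exact: sqr_ge0.
Qed.

Lemma fsum_int_window (R : nmodType) (F : int -> R) (i : int) (m : nat) :
  (forall k, F k != 0 -> (i <= k) && (k < i + m%:Z)) ->
  \sum_(k \in [set: int]) F k = \sum_(l < m) F (i + l%:Z).
Proof.
move=> Fsupp.
pose h (l : nat) : int := i + l%:Z.
rewrite (fsbig_ord _ m (F \o h)).
rewrite -(@fsbig_widen _ _ _ _ (h @` `I_m)) //; last first.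
  move=> k [_ /= hk]; apply/eqP/negPn/negP => /Fsupp /andP[ik ki].
  apply: hk; exists `|k - i|%N => /=; last by rewrite /h; lia.
  by lia.
by apply: fsbig_image => k l _ _; rewrite /h; lia.
Qed.

(** The indices [h l] may leave the window that carries [F], so the comparison takes place on the
    union of the two finite index sets. *)
Lemma sum_le_fsum (R : realDomainType) (F : int -> R) (i : int) (m n : nat)
    (h : nat -> int) :
  (forall k, 0 <= F k) -> (forall k, F k != 0 -> (i <= k) && (k < i + m%:Z)) ->
  injective h ->
  \sum_(l < n) F (h l) <= \sum_(k \in [set: int]) F k.
Proof.
move=> F0 Fsupp hinj.
pose g (l : nat) : int := i + l%:Z.
have fA : finite_set (h @` `I_n `|` g @` `I_m).
  by rewrite finite_setU; split; apply: finite_image; exact: finite_II.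
rewrite -(@fsbig_widen _ _ _ _ (h @` `I_n `|` g @` `I_m)) //; last first.
  move=> k [_ /= hk]; apply/eqP/negPn/negP => /Fsupp /andP[ik ki].
  apply: hk; right; exists `|k - i|%N => /=; last by rewrite /g; lia.
  by lia.
rewrite (fsbigID (h @` `I_n))// setIidr; last by move=> k; left.
rewrite fsbig_image; last by move=> k l _ _; exact: hinj.
rewrite -(fsbig_ord _ n (F \o h)) lerDl.
by apply: fsumr_ge0 => k _.
Qed.

(** Coefficients and position are separated because [a] will range over a finite grid and [i] over
    all integers. *)
Definition wavelet_sum (R : realType) (phi : R -> R) (m : nat) (a : 'I_m -> R)
    (i : int) (x : R) : R :=
  \sum_(l < m) a l * phi (x - (i + (l : nat)%:Z)%:~R).

Section window.
Context (R : realType) (phi : R -> R) (B1 B2 : R) (m : nat).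
Hypotheses (phi0 : forall x, ~ (B1 < x <= B2) -> phi x = 0)
  (Bm : B2 - B1 + 1 <= m%:R).

(** A nonzero [phi (u - k)] forces [u - B2 <= k < u - B1]. Rounding the left end down lengthens the
    window by less than one, hence the [+ 1] in [Bm]. *)
Definition window_start (u : R) : int := Num.floor (u - B2).

Definition window_coef (u : R) (l : 'I_m) : R :=
  phi (u - (window_start u + (l : nat)%:Z)%:~R).

Lemma translate_window u (k : int) : phi (u - k%:~R) != 0 ->
  (window_start u <= k) && (k < window_start u + m%:Z).
Proof.
move=> phik; have /andP[h1 h2] : B1 < u - k%:~R <= B2.
  by apply: contrapT => /phi0/eqP; apply/negP.
have f1 := floor_le (u - B2); have f2 := floorD1_gt (u - B2).
rewrite -/(window_start u) in f1 f2.
apply/andP; split.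
  by rewrite -(ler_int R); lra.
have aux (b k' w m' : R) : b < u - k' -> B2 - b + 1 <= m' ->
  u - B2 < w + 1 -> k' < w + m' by lra.
by rewrite -(ltr_int R) intrD -pmulrn; apply: aux h1 Bm _; rewrite -intrD1.
Qed.

Lemma wavelet_kernel_window u x :
  wavelet_kernel phi u x = wavelet_sum phi (window_coef u) (window_start u) x.
Proof.
rewrite /wavelet_kernel (@fsum_int_window _ _ (window_start u) m)//.
by move=> k; rewrite mulf_eq0 negb_or => /andP[/translate_window].
Qed.

Lemma sum_sq_translates_window u :
  sum_sq_translates phi u = \sum_(l < m) window_coef u l ^+ 2.
Proof.
rewrite /sum_sq_translates (@fsum_int_window _ _ (window_start u) m)//.
by move=> k; rewrite sqrf_eq0 => /translate_window.
Qed.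

Lemma sum_sq_injective_le u (h : nat -> int) n : injective h ->
  \sum_(l < n) phi (u - (h l)%:~R) ^+ 2 <= sum_sq_translates phi u.
Proof.
move=> hinj; apply: (@sum_le_fsum _ (fun k => phi (u - k%:~R) ^+ 2)
  (window_start u) m) => // k.
  exact: sqr_ge0.
by rewrite sqrf_eq0 => /translate_window.
Qed.

Lemma wavelet_sum_sqr_le (a : 'I_m -> R) i x :
  wavelet_sum phi a i x ^+ 2 <=
  (\sum_l a l ^+ 2) * sum_sq_translates phi x.
Proof.
apply: le_trans (sum_cauchy_schwarz _ _) _.
apply: ler_wpM2l; first by rewrite sumr_ge0// => l _; exact: sqr_ge0.
apply: (@sum_sq_injective_le x (fun l => i + l%:Z) m).
by move=> k l /=; lia.
Qed.

(** A given translate of [phi] occurs in at most [m] windows, once for each offset, so summing over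
    the windows costs only a factor [m], uniformly in [n]. *)
Lemma sum_wavelet_sum_sqr_le (a : 'I_m -> R) (e : nat -> int) n x D :
  injective e -> sum_sq_translates phi x <= D ->
  \sum_(k < n) wavelet_sum phi a (e k) x ^+ 2 <=
  (\sum_l a l ^+ 2) * (m%:R * D).
Proof.
move=> einj sD; have a0 : 0 <= \sum_l a l ^+ 2.
  by rewrite sumr_ge0// => l _; exact: sqr_ge0.
apply: (@le_trans _ _ (\sum_(k < n) (\sum_l a l ^+ 2) *
    (\sum_(l < m) phi (x - (e k + (l : nat)%:Z)%:~R) ^+ 2))).
  by apply: ler_sum => k _; exact: sum_cauchy_schwarz.
rewrite -mulr_sumr ler_wpM2l// exchange_big /=.
rewrite mulr_natl (_ : D *+ m = \sum_(l < m) D); last first.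
  by rewrite sumr_const card_ord.
apply: ler_sum => l _; apply: le_trans sD.
apply: (@sum_sq_injective_le x (fun k => e k + l%:Z) n).
by move=> k k' /addIr /einj.
Qed.

End window.

Section orthonormal.
Context (R : realType) (phi : R -> R) (hphi : father_wavelet phi).

Lemma measurable_father : measurable_fun [set: measurableTypeR R] phi.
Proof.
have := father_L2 hphi.
by move=> /sub_Lfun_mfun; rewrite inE.
Qed.

Lemma measurable_translate (k : int) :
  measurable_fun [set: measurableTypeR R] (fun x => phi (x - k%:~R)).
Proof.
apply: (measurableT_comp measurable_father).
exact: measurable_funB.
Qed.

Lemma measurable_wavelet_sum m (a : 'I_m -> R) i :
  measurable_fun [set: measurableTypeR R] (wavelet_sum phi a i).
Proof.
apply: measurable_sum => l; apply: measurable_funM => //.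
exact: measurable_translate.
Qed.

(** Orthonormality with equal indices gives square integrability, and mixed products are dominated
    by sums of squares. *)
Lemma integrable_translateM (k l : int) :
  (@lebesgue_measure R).-integrable setT
    (fun x => (phi (x - k%:~R) * phi (x - l%:~R))%:E).
Proof.
have sq (n : int) : (@lebesgue_measure R).-integrable setT
    (fun x => (phi (x - n%:~R) * phi (x - n%:~R))%:E).
  apply/integrableP; split.
    apply/measurable_EFinP; apply: measurable_funM; exact: measurable_translate.
  under eq_integral => x _ do rewrite gee0_abs ?lee_fin -?expr2 ?sqr_ge0//.
  under eq_integral => x _ do rewrite expr2.
  by rewrite father_orthonormal// ltry.
have := integrableD measurableT (sq k) (sq l).
apply: le_integrable => //.
  apply/measurable_EFinP; apply: measurable_funM; exact: measurable_translate.
move=> x _ /=; set p := phi (x - k%:~R); set q := phi (x - l%:~R).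
suff : `|p * q| <= `|p * p + q * q| by [].
rewrite [leRHS]ger0_norm; last by rewrite addr_ge0// -expr2 sqr_ge0.
rewrite ler_norml; have := sqr_ge0 (p + q); have := sqr_ge0 (p - q).
have := sqr_ge0 p; have := sqr_ge0 q.
by rewrite !expr2 => ? ? ? ?; nra.
Qed.

Lemma integral_wavelet_sum_sqr m (a : 'I_m -> R) i :
  (\int[lebesgue_measure]_x (wavelet_sum phi a i x ^+ 2)%:E =
   (\sum_l a l ^+ 2)%:E)%E.
Proof.
pose t (l : 'I_m) : int := i + (l : nat)%:Z.
have E x : ((wavelet_sum phi a i x ^+ 2)%:E =
  \sum_(p : 'I_m * 'I_m) ((a p.1 * a p.2)%:E *
     (phi (x - (t p.1)%:~R) * phi (x - (t p.2)%:~R))%:E))%E.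
  rewrite expr2 /wavelet_sum big_distrlr /= pair_bigA /= -sumEFin.
  by apply: eq_bigr => p _; rewrite -EFinM; congr EFin; rewrite /t; ring.
under eq_integral do rewrite E.
rewrite integral_sum//; last first.
  by move=> p; apply: integrableZl => //; exact: integrable_translateM.
transitivity (\sum_(p : 'I_m * 'I_m) (a p.1 * a p.2 * (t p.1 == t p.2)%:R)%:E)%E.
  apply: eq_bigr => p _; rewrite integralZl//; last exact: integrable_translateM.
  by rewrite father_orthonormal// -EFinM.
rewrite sumEFin; congr EFin.
rewrite -(pair_bigA _ (fun k l => a k * a l * (t k == t l)%:R)) /=.
apply: eq_bigr => k _; rewrite (bigD1 k)//= eqxx mulr1 expr2 big1 ?addr0// => l lk.
have -> : (t k == t l) = false; last by rewrite mulr0.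
apply/negbTE; apply: contra_neq lk => /addrI [] /ord_inj.
by [].
Qed.

End orthonormal.

(** * Tails of the wavelet sums *)

Lemma expect_sum d (T : measurableType d) (R : realType) (P : probability T R)
    (I : Type) (r : seq I) (f : I -> T -> R) :
  (forall i, bounded_measurable (f i)) ->
  \sum_(i <- r) \int[P]_x f i x = \int[P]_x \sum_(i <- r) f i x.
Proof.
move=> bf; elim: r => [|i r IH].
  by under eq_Rintegral do rewrite big_nil; rewrite expect_cst big_nil.
under eq_Rintegral do rewrite big_cons.
rewrite RintegralD//; last 2 first.
  exact/bounded_measurable_integrable.
  exact/bounded_measurable_integrable/bounded_measurable_sum.
by rewrite big_cons IH.
Qed.

Definition centered d (T : measurableType d) (R : realType) (P : probability T R)
    (f : T -> R) (x : T) : R :=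
  f x - \int[P]_y f y.

Section window_tail.
Context (R : realType) (phi : R -> R) (B1 B2 : R) (m : nat).
Hypotheses (hphi : father_wavelet phi)
  (phi0 : forall x, ~ (B1 < x <= B2) -> phi x = 0)
  (Bm : B2 - B1 + 1 <= m%:R).
Variables (D : R).
Hypotheses (D0 : 0 <= D) (sD : forall x, sum_sq_translates phi x <= D ^+ 2).
Variables (P : probability (measurableTypeR R) R)
  (PN : probability (seq_space R) R) (p0 : R -> R) (c : R).
Hypotheses (hPN : is_product_measure P PN) (dP : has_density P p0)
  (p0c : forall x, p0 x <= c).
Variables (s : R) (s0 : 0 < s).

Definition scaled_wavelet_sum (a : 'I_m -> R) (i : int) (x : R) : R :=
  wavelet_sum phi a i (s * x).

Lemma bounded_measurable_scaled_wavelet_sum a i :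
  @bounded_measurable _ (measurableTypeR R) R (scaled_wavelet_sum a i).
Proof.
split.
  apply: (measurableT_comp (measurable_wavelet_sum hphi a i)).
  exact: measurable_funM.
exists (Num.sqrt ((\sum_l a l ^+ 2) * D ^+ 2)) => x.
rewrite -sqrtr_sqr ler_wsqrtr//.
apply: le_trans (wavelet_sum_sqr_le phi0 Bm _ _ _) _.
by rewrite ler_wpM2l// sumr_ge0// => l _; exact: sqr_ge0.
Qed.

Lemma bounded_measurable_sqr d (T : measurableType d) (f : T -> R) :
  bounded_measurable f -> bounded_measurable (fun x => f x ^+ 2).
Proof.
by move=> bf; under eq_fun do rewrite expr2; exact: bounded_measurableM.
Qed.

Lemma expect_scaled_wavelet_sum_sqr_le a i : \sum_l a l ^+ 2 <= 1 ->
  \int[P]_x (scaled_wavelet_sum a i x ^+ 2) <= c / s.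
Proof.
move=> a1; have bw := bounded_measurable_scaled_wavelet_sum a i.
have c0 : 0 <= c by case: dP => _ p00 _; exact: le_trans (p00 0) (p0c 0).
rewrite -lee_fin -expect_EFin; last exact: bounded_measurable_sqr.
apply: le_trans.
  apply: (density_scaled_integral_le (f := fun x => wavelet_sum phi a i x ^+ 2)
    dP p0c s0).
    apply: measurable_funX; exact: measurable_wavelet_sum.
  by move=> x; exact: sqr_ge0.
rewrite integral_wavelet_sum_sqr// -EFinM lee_fin ler_piMr//.
by rewrite divr_ge0// ltW.
Qed.

(** Unlike the bound [c / s] for one window, this one is obtained pointwise before integration. It
    is independent of [n], so it survives the passage to infinitely many windows. *)
Lemma sum_expect_scaled_wavelet_sum_sqr_le a (e : nat -> int) n :
  \sum_l a l ^+ 2 <= 1 -> injective e ->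
  \sum_(k < n) \int[P]_x (scaled_wavelet_sum a (e k) x ^+ 2) <= m%:R * D ^+ 2.
Proof.
move=> a1 einj.
have bw k : @bounded_measurable _ (measurableTypeR R) R
    (fun x => scaled_wavelet_sum a (e k) x ^+ 2).
  apply: bounded_measurable_sqr; exact: bounded_measurable_scaled_wavelet_sum.
rewrite (expect_sum P _ (fun k : 'I_n => bw k)) -[leRHS](expect_cst P).
apply: expect_le; first exact: bounded_measurable_sum.
  exact: bounded_measurable_cst.
move=> x; apply: le_trans.
  exact: (sum_wavelet_sum_sqr_le phi0 Bm a n einj (sD (s * x))).
by rewrite ler_piMl// mulr_ge0 ?ler0n ?sqr_ge0.
Qed.

Lemma bounded_measurable_centered i a :
  @bounded_measurable _ (measurableTypeR R) R
    (@centered _ (measurableTypeR R) R P (scaled_wavelet_sum a i)).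
Proof.
apply: bounded_measurableB; last exact: bounded_measurable_cst.
exact: bounded_measurable_scaled_wavelet_sum.
Qed.

(** In the bound for a single walk, the variance in the exponent is replaced by [c / s], which makes
    that factor independent of the window; the linear variance factor is kept and summed to
    [m * D ^ 2]. *)
Lemma window_tail_bound a (e : nat -> int) (N : nat) (l t : R) :
  \sum_l a l ^+ 2 <= 1 -> injective e ->
  0 < l -> l * (2 * D) <= 3^-1 -> 4 <= l * t ->
  (PN (\bigcup_k walk_exceeds
     (@centered _ (measurableTypeR R) R P (scaled_wavelet_sum a (e k))) N 0 t) <=
     (2 * expR (- (l * t)) * (N%:R * l ^+ 2) * expR (N%:R * l ^+ 2 * (c / s))
       * (m%:R * D ^+ 2))%:E)%E.
Proof.
move=> a1 einj l0 lD lt4.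
pose v k := \int[P]_x (scaled_wavelet_sum a (e k) x ^+ 2).
set C := 2 * expR (- (l * t)) * _ * _.
have C0 : 0 <= C.
  rewrite /C; do ?[apply: mulr_ge0]; rewrite ?expR_ge0 ?ler0n//; exact: ltW.
have bw k := bounded_measurable_scaled_wavelet_sum a (e k).
have wD k x : `|scaled_wavelet_sum a (e k) x| <= D.
  rewrite -(@ler_pXn2r _ 2)// ?nnegrE// real_normK ?num_real//.
  apply: le_trans (wavelet_sum_sqr_le phi0 Bm _ _ _) _.
  apply: le_trans (sD (s * x)); rewrite ler_piMl//.
  by apply: fsumr_ge0 => i _; exact: sqr_ge0.
have mE k : measurable (walk_exceeds
    (@centered _ (measurableTypeR R) R P (scaled_wavelet_sum a (e k))) N 0 t).
  by apply: measurable_walk_exceeds; have [] := bounded_measurable_centered (e k) a.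
apply: le_trans.
  by apply: generalized_Boole_inequality => //; exact: bigcupT_measurable.
apply: (@le_trans _ _ (\sum_(0 <= k <oo) (C * v k)%:E)%E).
  apply: lee_nneseries => // k _.
  apply: le_trans.
    apply: (@walk_tail_bound _ P _ _ (2 * D) l (v k)) => //.
    - exact: bounded_measurable_centered.
    - move=> x.
      rewrite mulr_natl mulr2n (le_trans (ler_normB _ _))// lerD//.
      have /(le_normr_Rintegral measurableT) h :=
        bounded_measurable_integrable P (bw k).
      apply: le_trans h _.
      rewrite -[leRHS](expect_cst P); apply: expect_le => //.
        have [mw [b wb]] := bw k; split; first exact: measurableT_comp.
        by exists b => y; rewrite normr_id.
      exact: bounded_measurable_cst.
    - exact: expectB_mean.
    - exact: expect_sqr_centered.
  have vc : v k <= c / s by exact: expect_scaled_wavelet_sum_sqr_le.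
  have v0 : 0 <= v k by rewrite /v Rintegral_ge0// => x _; exact: sqr_ge0.
  rewrite lee_fin /C [leRHS]mulrAC !mulrA ler_wpM2l//.
    by do ?[apply: mulr_ge0]; rewrite ?expR_ge0 ?sqr_ge0 ?ler0n//; exact: ltW.
  rewrite ler_expR -[leRHS]mulrA ler_wpM2l//.
  by rewrite -mulrA mulr_ge0 ?ler0n// -expr2 sqr_ge0.
apply: (@lime_le _ _ _ R (C * (m%:R * D ^+ 2))%:E
  (fun n => \sum_(0 <= k < n) (C * v k)%:E)%E).
  apply: is_cvg_nneseries => k _ _; rewrite lee_fin mulr_ge0//.
  by rewrite /v Rintegral_ge0// => x _; exact: sqr_ge0.
apply: nearW => n; rewrite sumEFin lee_fin -mulr_sumr ler_wpM2l//.
by rewrite big_mkord sum_expect_scaled_wavelet_sum_sqr_le.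
Qed.

End window_tail.

(** * Norming grid *)

Definition grid_point (R : realType) (m : nat)
    (g : {ffun 'I_m -> bool * 'I_(2 * m).+1}) (l : 'I_m) : R :=
  (-1) ^+ (g l).1 * ((g l).2%:R / (2 * m)%:R).

(* Rounding the coordinates of the unit vector [S / |S|] towards [0] does not
   increase its norm, and moves each of them by at most [1 / (2 * m)]. *)
Lemma grid_norming (R : realType) (m : nat) (S : 'I_m -> R) :
  exists g : {ffun 'I_m -> bool * 'I_(2 * m).+1},
    \sum_l grid_point R g l ^+ 2 <= 1 /\
    Num.sqrt (\sum_l S l ^+ 2) <= 2 * \sum_l grid_point R g l * S l.
Proof.
set r2 := \sum_l S l ^+ 2; set r := Num.sqrt r2.
have r20 : 0 <= r2 by rewrite sumr_ge0// => l _; exact: sqr_ge0.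
have [r0|r0] := eqVneq r2 0.
  exists [ffun=> (false, ord0)].
  have E (l : 'I_m) : grid_point R [ffun=> (false, ord0)] l = 0.
    by rewrite /grid_point ffunE /= mul0r mulr0.
  under eq_bigr do rewrite E expr0n.
  under [X in _ /\ _ <= 2 * X]eq_bigr do rewrite E mul0r.
  by rewrite /r r0 sqrtr0 !big1// mulr0; split.
have rp : 0 < r by rewrite sqrtr_gt0 lt_neqAle eq_sym r0.
have rr : r ^+ 2 = r2 by rewrite sqr_sqrtr.
have Sr l : `|S l| <= r.
  rewrite -(@ler_pXn2r _ 2)// ?nnegrE ?(ltW rp)// real_normK ?num_real// rr.
  by rewrite /r2 (bigD1 l)//= lerDl sumr_ge0// => k _; exact: sqr_ge0.
case: m S @r2 @r r20 r0 rp rr Sr => [|m] S r2 r r20 r0 rp rr Sr.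
  by move: r0; rewrite /r2 big_ord0 eqxx.
have q0 : (0 : R) < (2 * m.+1)%:R by rewrite ltr0n.
pose q : R := (2 * m.+1)%:R.
have qS l : 0 <= q * (`|S l| / r).
  exact: mulr_ge0 (ltW q0) (divr_ge0 (normr_ge0 (S l)) (ltW rp)).
pose k l := Num.truncn (q * (`|S l| / r)).
have kq l : (k l)%:R / q <= `|S l| / r.
  rewrite ler_pdivrMr// [leRHS]mulrC.
  by have /andP[] := truncn_itv (qS l).
have kq' l : `|S l| / r - (k l)%:R / q <= q^-1.
  rewrite lerBlDr -[X in _ <= X + _]mul1r -mulrDl ler_pdivlMr// mulrC.
  have /andP[_] := truncn_itv (qS l).
  by rewrite -/(k l) => /ltW; rewrite -natr1 addrC.
have k_lt l : (k l < (2 * m.+1).+1)%N.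
  rewrite ltnS -(ler_nat R) -/q.
  have := kq l; rewrite ler_pdivrMr// => /le_trans; apply.
  by rewrite ler_piMl ?(ltW q0)// ler_pdivrMr// mul1r.
exists [ffun l => (S l < 0, Ordinal (k_lt l))].
have E l : grid_point R [ffun l => (S l < 0, Ordinal (k_lt l))] l =
    (-1) ^+ (S l < 0)%R * ((k l)%:R / q).
  by rewrite /grid_point ffunE.
have kq0 l : 0 <= (k l)%:R / q by rewrite divr_ge0// ltW.
split.
  rewrite (_ : 1 = \sum_l (S l / r) ^+ 2); last first.
    under eq_bigr do rewrite expr_div_n.
    by rewrite -mulr_suml -/r2 rr mulfV.
  apply: ler_sum => l _; rewrite E exprMn -signr_odd -exprM muln2.
  rewrite -signr_odd odd_double expr0 mul1r.
  rewrite -[leRHS]real_normK ?num_real// lerXn2r ?nnegrE//.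
  by rewrite normrM [`|r^-1|]ger0_norm ?invr_ge0 ?(ltW rp).
have ES l : grid_point R [ffun l => (S l < 0, Ordinal (k_lt l))] l * S l =
    (k l)%:R / q * `|S l|.
  rewrite E [RHS]mulrC normrEsign; ring.
have Srr : r = \sum_l `|S l| / r * `|S l|.
  under eq_bigr do rewrite mulrAC -normrM -expr2 ger0_norm ?sqr_ge0//.
  by rewrite -mulr_suml -/r2 -rr expr2 mulfK// gt_eqF.
(* Each of the [m.+1] coordinates loses at most [r / q], and [q] is twice their number: the mesh is
   chosen so that exactly half of the norm can be lost. *)
have : r - \sum_l (k l)%:R / q * `|S l| <= r / 2.
  rewrite {1}Srr -sumrB.
  apply: (@le_trans _ _ (\sum_(l < m.+1) q^-1 * r)).
    apply: ler_sum => l _; rewrite -mulrBl ler_pM// subr_ge0//.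
  rewrite sumr_const card_ord -[leLHS]mulr_natl /q natrM.
  have m0 : m.+1%:R != 0 :> R by rewrite pnatr_eq0.
  by rewrite le_eqVlt; apply/orP; left; apply/eqP; field.
under [X in _ -> _ <= 2 * X]eq_bigr do rewrite ES.
by lra.
Qed.

(** * Deviations of the density estimator *)

Section coordinate_law.
Context (R : realType) (P : probability (measurableTypeR R) R)
  (PN : probability (seq_space R) R) (hPN : is_product_measure P PN).

Lemma coordinate_law (i : nat) (B : set (measurableTypeR R)) : measurable B ->
  PN [set w | B (w i)] = P B.
Proof.
move=> mB; pose C k := if k == i then B else [set: measurableTypeR R].
have mC k : measurable (C k) by rewrite /C; case: ifP.
rewrite (_ : [set w | B (w i)] = [set w | forall k, (k < i.+1)%N -> C k (w k)]).
  rewrite hPN// big_ord_recr /= big1 ?mul1e /C ?eqxx//.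
  by move=> k _; rewrite ltn_eqF ?ltn_ord//=; exact: probability_setT.
apply/seteqP; split=> w /= => [Bw k _|/(_ i)]; rewrite /C ?eqxx; last exact.
by case: eqP => // ->.
Qed.

Lemma bounded_measurable_coordinate (f : R -> R) (i : nat) :
  @bounded_measurable _ (measurableTypeR R) R f ->
  @bounded_measurable _ (seq_space R) R (fun w => f (w i)).
Proof.
move=> [mf [b fb]]; split; last by exists b.
exact: (measurableT_comp mf (@measurable_coordinate R i)).
Qed.

Lemma expect_coordinate (f : R -> R) (i : nat) :
  @bounded_measurable _ (measurableTypeR R) R f ->
  \int[PN]_w f (w i) = \int[P]_x f x.
Proof.
move=> bf; congr fine.
have mc := @measurable_coordinate R i.
pose X : {RV PN >-> measurableTypeR R} :=
  @mfun_Sub _ _ (seq_space R) (measurableTypeR R) _ (mem_set mc).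
transitivity (\int[distribution PN X]_x (f x)%:E)%E.
  rewrite integral_distribution//.
    by apply/measurable_EFinP; case: bf.
  apply: bounded_measurable_integrable; exact: bounded_measurable_coordinate.
apply: eq_measure_integral => A mA _.
exact: coordinate_law.
Qed.

End coordinate_law.

Section deviation.
Context (R : realType) (phi : R -> R) (B1 B2 : R) (m : nat).
Hypotheses (hphi : father_wavelet phi)
  (phi0 : forall x, ~ (B1 < x <= B2) -> phi x = 0)
  (Bm : B2 - B1 + 1 <= m%:R).
Variables (D : R).
Hypotheses (D0 : 0 <= D) (sD : forall x, sum_sq_translates phi x <= D ^+ 2)
  (s_gt0 : forall x, 0 < sum_sq_translates phi x).
Variables (P : probability (measurableTypeR R) R)
  (PN : probability (seq_space R) R) (hPN : is_product_measure P PN).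

Definition translate_walk (s : R) (n : nat) (k : int) (w : seq_space R) : R :=
  walk (@centered _ (measurableTypeR R) R P (fun x => phi (s * x - k%:~R))) n w.

Lemma bounded_measurable_translate (s : R) (k : int) :
  @bounded_measurable _ (measurableTypeR R) R (fun x => phi (s * x - k%:~R)).
Proof.
split.
  apply: (measurableT_comp (measurable_translate hphi k)).
  exact: measurable_funM.
exists D => x; rewrite -(@ler_pXn2r _ 2)// ?nnegrE// real_normK ?num_real//.
apply: le_trans (sD (s * x)).
have := @sum_sq_injective_le _ phi B1 B2 m phi0 Bm (s * x) (fun l => k + l%:Z) 1.
by rewrite big_ord1 addr0; apply => i j /addrI[].
Qed.

(** The scalar product of a fixed vector with the vector of translate walks is again a walk with
    i.i.d. centered steps, so the maximal inequality applies to it. *)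
Lemma walk_wavelet_sum (s : R) (a : 'I_m -> R) (i : int) n w :
  walk (@centered _ (measurableTypeR R) R P (scaled_wavelet_sum phi s a i)) n w =
  \sum_l a l * translate_walk s n (i + (l : nat)%:Z) w.
Proof.
rewrite /translate_walk /walk; under [RHS]eq_bigr do rewrite mulr_sumr.
rewrite exchange_big /=; apply: eq_bigr => k _.
rewrite /centered /scaled_wavelet_sum /wavelet_sum -expect_sum; last first.
  by move=> l; apply: bounded_measurableZ; exact: bounded_measurable_translate.
rewrite -sumrB; apply: eq_bigr => l _; rewrite mulrBr RintegralZl//.
by apply: bounded_measurable_integrable; exact: bounded_measurable_translate.
Qed.

Let kernel_bm (s u : R) :
  @bounded_measurable _ (measurableTypeR R) R
    (fun x => wavelet_kernel phi u (s * x)).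
Proof.
under eq_fun do rewrite (wavelet_kernel_window phi0 Bm).
exact: (bounded_measurable_scaled_wavelet_sum hphi phi0 Bm sD).
Qed.

Lemma deviation_walk (j : nat -> nat) n y w :
  let u := 2 ^+ j n * y in
  density_estimator phi j n y w - fine ('E_PN[density_estimator phi j n y])%E =
  n%:R^-1 * (2 ^+ j n * \sum_(l < m) @window_coef _ phi B2 m u l *
    translate_walk (2 ^+ j n) n (window_start B2 u + (l : nat)%:Z) w).
Proof.
move=> u.
rewrite -walk_wavelet_sum.
have -> : fine ('E_PN[density_estimator phi j n y])%E =
    n%:R^-1 * \sum_(i < n) (2 ^+ j n *
      \int[P]_x wavelet_kernel phi u (2 ^+ j n * x)).
  rewrite unlock -/(Rintegral _ _ _) /density_estimator.
  have bk (i : 'I_n) := bounded_measurableZ (2 ^+ j n)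
    (bounded_measurable_coordinate i (kernel_bm (2 ^+ j n) u)).
  rewrite RintegralZl//; last first.
    by apply: bounded_measurable_integrable; exact: bounded_measurable_sum.
  rewrite -expect_sum//; apply: congr1; apply: eq_bigr => i _.
  rewrite RintegralZl//; last first.
    apply: bounded_measurable_integrable.
    exact: (bounded_measurable_coordinate i (kernel_bm (2 ^+ j n) u)).
  by rewrite (expect_coordinate hPN i (kernel_bm (2 ^+ j n) u)).
rewrite /density_estimator -mulrBr -sumrB; apply: congr1.
rewrite /walk mulr_sumr.
apply: eq_bigr => i _; rewrite -mulrBr /centered; congr (_ * (_ - _)).
  exact: (wavelet_kernel_window phi0 Bm).
by apply: eq_Rintegral => x _; exact: (wavelet_kernel_window phi0 Bm).
Qed.

(** By Cauchy-Schwarz the norm of the coefficient vector cancels the normalization by the root of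
    [sum_sq_translates]. One-sided bounds on the walks suffice, since the norming grid point is
    aligned with the vector. *)
Lemma deviation_le (j : nat -> nat) n y w t :
  (forall i (g : {ffun 'I_m -> bool * 'I_(2 * m).+1}),
     \sum_l grid_point R g l ^+ 2 <= 1 ->
     walk (@centered _ (measurableTypeR R) R P
       (scaled_wavelet_sum phi (2 ^+ j n) (grid_point R g) i)) n w <= t) ->
  `| (density_estimator phi j n y w
          - fine ('E_PN[density_estimator phi j n y])%E)
       / Num.sqrt (sum_sq_translates phi (2 ^+ j n * y)) | <=
  n%:R^-1 * (2 ^+ j n * (2 * t)).
Proof.
move=> ht; set u := 2 ^+ j n * y.
have sp : 0 < Num.sqrt (sum_sq_translates phi u) by rewrite sqrtr_gt0.
rewrite deviation_walk -/u normrM normfV (ger0_norm (ltW sp)) ler_pdivrMr//.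
rewrite normrM ger0_norm ?invr_ge0// -mulrA ler_wpM2l ?invr_ge0//.
rewrite normrM ger0_norm ?exprn_ge0// -mulrA ler_wpM2l ?exprn_ge0//.
set S := fun l : 'I_m =>
  translate_walk (2 ^+ j n) n (window_start B2 u + (l : nat)%:Z) w.
have [g [g1 gS]] := grid_norming S.
apply: (@le_trans _ _ (Num.sqrt (\sum_l S l ^+ 2) *
    Num.sqrt (sum_sq_translates phi u))).
  rewrite -sqrtrM; last by rewrite sumr_ge0// => l _; exact: sqr_ge0.
  rewrite -sqrtr_sqr ler_wsqrtr// mulrC (sum_sq_translates_window phi0 Bm).
  exact: sum_cauchy_schwarz.
rewrite ler_wpM2r ?sqrtr_ge0//; apply: le_trans gS _.
by rewrite ler_wpM2l// -walk_wavelet_sum ht.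
Qed.

Lemma kernel_norm_le u x :
  `|wavelet_kernel phi u x| <= Num.sqrt (sum_sq_translates phi u) * D.
Proof.
have -> : Num.sqrt (sum_sq_translates phi u) * D =
    Num.sqrt (sum_sq_translates phi u * D ^+ 2).
  by rewrite sqrtrM ?(ltW (s_gt0 u))// sqrtr_sqr ger0_norm.
rewrite -sqrtr_sqr ler_wsqrtr//.
rewrite (wavelet_kernel_window phi0 Bm).
apply: le_trans (wavelet_sum_sqr_le phi0 Bm _ _ _) _.
by rewrite -(sum_sq_translates_window phi0 Bm) ler_wpM2l// ltW.
Qed.

(** At most [n1] kernel terms change, each by at most [2 * D] times the normalizing root, and that
    root cancels; the bound is thus uniform in [y]. *)
Lemma deviation_tail_le (j : nat -> nat) n y (w w' : seq_space R) n1 :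
  (forall i, (n1 <= i)%N -> w i = w' i) ->
  `| (density_estimator phi j n y w
          - fine ('E_PN[density_estimator phi j n y])%E)
       / Num.sqrt (sum_sq_translates phi (2 ^+ j n * y)) | <=
  `| (density_estimator phi j n y w'
          - fine ('E_PN[density_estimator phi j n y])%E)
       / Num.sqrt (sum_sq_translates phi (2 ^+ j n * y)) | +
  n%:R^-1 * (2 ^+ j n * (n1%:R * (2 * D))).
Proof.
move=> ww'; set u := 2 ^+ j n * y; set E := fine _.
set r := Num.sqrt _; have rp : 0 < r by rewrite sqrtr_gt0.
set d := density_estimator _ _ _ _ w; set d' := density_estimator _ _ _ _ w'.
have -> : (d - E) / r = (d' - E) / r + (d - d') / r by field; exact: lt0r_neq0.
rewrite (le_trans (ler_normD _ _))// lerD2l.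
rewrite normrM normfV (ger0_norm (ltW rp)) ler_pdivrMr//.
rewrite /d /d' /density_estimator -mulrBr -!mulr_sumr -mulrBr.
rewrite normrM ger0_norm ?invr_ge0// -mulrA ler_wpM2l ?invr_ge0//.
rewrite normrM ger0_norm ?exprn_ge0// -mulrA ler_wpM2l ?exprn_ge0//.
rewrite -sumrB (le_trans (ler_norm_sum _ _ _))//.
apply: (@le_trans _ _ (\sum_(i < n) if (i < n1)%N then 2 * D * r else 0)).
  apply: ler_sum => i _; case: ifPn => [_|]; last first.
    by rewrite -leqNgt => /ww' ->; rewrite subrr normr0.
  apply: le_trans (ler_normB _ _) _.
  have h z : `|wavelet_kernel phi u z| <= r * D by exact: kernel_norm_le.
  have -> : 2 * D * r = r * D + r * D by ring.
  exact: lerD.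
rewrite -big_mkcond /= sumr_const -[leLHS]mulr_natl -[leRHS]mulrA ler_wpM2r//.
  by rewrite !mulr_ge0// ltW.
rewrite ler_nat cardE -(size_map val) -[leqRHS](size_iota 0).
apply: uniq_leq_size; first by rewrite map_inj_uniq ?enum_uniq//; exact: val_inj.
by move=> _ /mapP[i /[swap] -> /=]; rewrite mem_enum mem_iota.
Qed.

End deviation.

(** * Limits superior and measurability of suprema *)

Lemma limn_esup_le (R : realType) (u : nat -> \bar R) (x : \bar R) N :
  (forall n, (N <= n)%N -> (u n <= x)%E) -> (limn_esup u <= x)%E.
Proof.
move=> ux; rewrite limn_esup_lim.
apply: lime_le; first exact: is_cvg_esups.
exists N => // n /= Nn; apply: ge_ereal_sup => _ [k /= nk <-].
by apply: ux; exact: leq_trans nk.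
Qed.

Lemma limn_esup_lt (R : realType) (u : nat -> \bar R) (x : \bar R) :
  (limn_esup u < x)%E -> exists N, forall n, (N <= n)%N -> (u n <= x)%E.
Proof.
move=> ux.
have [N Nx] : exists N, (esups u N < x)%E.
  apply: contrapT => /forallNP h; move: ux; rewrite ltNge => /negP; apply.
  rewrite limn_esup_lim; apply: lime_ge; first exact: is_cvg_esups.
  by apply: nearW => n; rewrite leNgt; exact/negP/h.
exists N => n Nn; apply: le_trans (ltW Nx); apply: ereal_sup_ubound.
by exists n.
Qed.

Lemma limn_esup_le_perturbation (R : realType) (u v : nat -> \bar R)
    (e : nat -> R) :
  (forall n, (0 <= v n)%E) -> (forall n, (u n <= v n + (e n)%:E)%E) ->
  (forall d, 0 < d -> exists N, forall n, (N <= n)%N -> e n <= d) ->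
  (limn_esup u <= limn_esup v)%E.
Proof.
move=> v0 uv ed.
have key (r : R) : (limn_esup v < r%:E)%E -> (limn_esup u <= r%:E)%E.
  move=> /limn_esup_lt[N vN]; apply/lee_addgt0Pr => d d0.
  have [N' eN'] := ed d d0.
  apply: (@limn_esup_le _ _ _ (maxn N N')) => n; rewrite geq_max => /andP[n1 n2].
  by apply: le_trans (uv n) _; rewrite leeD// ?vN// lee_fin eN'.
have : (0 <= limn_esup v)%E.
  rewrite limn_esup_lim; apply: lime_ge; first exact: is_cvg_esups.
  apply: nearW => n; apply: le_trans (v0 n) _.
  by apply: ereal_sup_ubound; exists n => /=.
case: (limn_esup v) key => [x| |] key; rewrite ?leey// => _.
apply/lee_addgt0Pr => d d0; rewrite -EFinD; apply: key.
by rewrite lte_fin ltrDl.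
Qed.

Section sup_measurable.
Context d (T : measurableType d) (R : realType) (m : nat).
Variables (c : R) (b : R -> 'I_m -> R) (i : R -> int) (S : int -> 'I_m -> T -> R).
Hypothesis mS : forall k l, measurable_fun setT (S k l).

Let F y w := c * \sum_l b y l * S (i y) l w.

(* [F y] depends on [y] only through [i y] and [b y]; one [y] for each value of
   [i y] and of [b y] rounded to each precision determines the supremum. *)
Let code := (int * nat * {ffun 'I_m -> int})%type.

Let encode (y : R) (q : nat) : code :=
  (i y, q, [ffun l => Num.floor (b y l * q.+1%:R)]).

Let decode (k : code) : R := xget 0 [set y | encode y k.1.2 = k].

Let encode_decode y q : encode (decode (encode y q)) q = encode y q.
Proof.
by apply: (@xgetI _ 0 [set z | encode z (encode y q).1.2 = encode y q] y).
Qed.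

Let mF y : measurable_fun setT (F y).
Proof.
apply: measurable_funM => //; apply: measurable_sum => l.
exact: measurable_funM.
Qed.

Let F_decode y w e : 0 < e ->
  exists q, `|F y w| <= `|F (decode (encode y q)) w| + e.
Proof.
move=> e0.
(* A Lipschitz constant of [F] in its coefficients for the maximum norm, at the fixed [w]. *)
pose M := `|c| * \sum_l `|S (i y) l w|.
have M0 : 0 <= M by rewrite mulr_ge0// sumr_ge0.
have [q qM] : exists q, M / q.+1%:R <= e.
  exists (Num.truncn (M / e)); rewrite ler_pdivrMr// mulrC -ler_pdivrMr//.
  have /andP[_ /ltW] := truncn_itv (divr_ge0 M0 (ltW e0)).
  by [].
exists q; set y' := decode _.
have [iy' by'] : i y' = i y /\ forall l, `|b y l - b y' l| <= q.+1%:R^-1.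
  have /pair_equal_spec[/pair_equal_spec[iE _] /ffunP bE] := encode_decode y q.
  split=> // l; have := bE l; rewrite !ffunE -/y' => fE.
  have f1 := floor_le (b y l * q.+1%:R).
  have f2 := floorD1_gt (b y l * q.+1%:R).
  have f3 := floor_le (b y' l * q.+1%:R).
  have f4 := floorD1_gt (b y' l * q.+1%:R).
  rewrite fE !intrD1 in f1 f2 f3 f4.
  rewrite -[leRHS]mul1r ler_pdivlMr// -[X in _ * X]ger0_norm// -normrM mulrBl.
  rewrite ler_norml; apply/andP; split; lra.
apply: le_trans (lerD (lexx _) qM); rewrite -lerBlDl.
apply: le_trans (lerB_dist _ _) _; rewrite /F iy' -mulrBr -sumrB normrM.
rewrite /M -mulrA ler_wpM2l// mulr_suml (le_trans (ler_norm_sum _ _ _))//.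
apply: ler_sum => l _; rewrite -mulrBl normrM mulrC.
by rewrite ler_wpM2l.
Qed.

Lemma measurable_fun_sup_linear :
  measurable_fun setT (fun w => ereal_sup (range (fun y : R => `|F y w|%:E))).
Proof.
(* Where [unpickle] fails, 0 is just another admissible [y], which cannot enlarge the supremum. *)
pose G n w := (`|F (if @unpickle code n is Some k then decode k else 0) w|%:E)%E.
rewrite (_ : (fun w => _) = (fun w => esups (G ^~ w) 0)).
  apply: measurable_fun_esups => n; apply/measurable_EFinP.
  by apply: measurableT_comp => //; exact: mF.
apply/funext => w; apply/eqP; rewrite eq_le; apply/andP; split.
  apply: ge_ereal_sup => _ [y _ <-]; apply/lee_addgt0Pr => e e0.
  have [q yq] := F_decode y w e0.
  apply: (@le_trans _ _ (`|F (decode (encode y q)) w|%:E + e%:E)%E).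
    by rewrite -EFinD lee_fin.
  rewrite leeD2r//; apply: ereal_sup_ubound; exists (pickle (encode y q)) => //.
  by rewrite /G pickleK.
apply: ge_ereal_sup => _ [n _ <-]; apply: ereal_sup_ubound.
by eexists.
Qed.

End sup_measurable.

(** * Measurability and tail invariance of the normalized limsup *)

Section limit.
Context (R : realType) (phi : R -> R) (B1 B2 : R) (m : nat).
Hypotheses (hphi : father_wavelet phi)
  (phi0 : forall x, ~ (B1 < x <= B2) -> phi x = 0)
  (Bm : B2 - B1 + 1 <= m%:R).
Variables (D : R).
Hypotheses (D0 : 0 < D) (sD : forall x, sum_sq_translates phi x <= D ^+ 2)
  (s_gt0 : forall x, 0 < sum_sq_translates phi x).
Variables (P : probability (measurableTypeR R) R)
  (PN : probability (seq_space R) R) (hPN : is_product_measure P PN).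
Variables (j : nat -> nat).

Lemma normalized_deviation_ge0 n w : (0 <= normalized_deviation phi j PN n w)%E.
Proof.
apply: (@le_trans _ _ (`| (density_estimator phi j n 0 w
          - fine ('E_PN[density_estimator phi j n 0])%E)
       / Num.sqrt (sum_sq_translates phi (2 ^+ j n * 0)) |%:E)).
  by rewrite lee_fin.
by apply: ereal_sup_ubound; exists 0.
Qed.

(** [phi] may have jumps, so rational [y] need not determine the supremum. Instead, the deviation is
    linear in finitely many measurable walks per window, and only their coefficients depend on
    [y]. *)
Lemma measurable_normalized_deviation n :
  measurable_fun [set: seq_space R] (normalized_deviation phi j PN n).
Proof.
pose b (y : R) (l : 'I_m) := window_coef phi B2 (2 ^+ j n * y) l /
  Num.sqrt (sum_sq_translates phi (2 ^+ j n * y)).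
pose S (k : int) (l : 'I_m) := translate_walk phi P (2 ^+ j n) n (k + (l : nat)%:Z).
have mS k l : measurable_fun [set: seq_space R] (S k l).
  apply: measurable_walk; apply: measurable_funB => //.
  by have [] := bounded_measurable_translate hphi phi0 Bm (ltW D0) sD
    (2 ^+ j n) (k + (l : nat)%:Z).
have := measurable_fun_sup_linear (n%:R^-1 * 2 ^+ j n) b
  (fun y => window_start B2 (2 ^+ j n * y)) mS.
apply: eq_measurable_fun => w _; rewrite /normalized_deviation; congr ereal_sup.
apply: (congr1 (fun f => range f)); apply/funext => y; congr (`|_|%:E).
rewrite (deviation_walk hphi phi0 Bm (ltW D0) sD hPN) -mulrA -[RHS]mulrA.
congr (_ * _).
rewrite -[RHS]mulrA; congr (_ * _); rewrite mulr_suml; apply: eq_bigr => l _.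
by rewrite /b mulrAC.
Qed.

Lemma normalized_deviation_tail_le n n1 (w w' : seq_space R) :
  (forall i, (n1 <= i)%N -> w i = w' i) ->
  (normalized_deviation phi j PN n w <= normalized_deviation phi j PN n w' +
     (n%:R^-1 * (2 ^+ j n * (n1%:R * (2 * D))))%:E)%E.
Proof.
move=> ww'; rewrite {1}/normalized_deviation; apply: ge_ereal_sup => _ [y _ <-].
have h := deviation_tail_le phi0 Bm (ltW D0) sD s_gt0 PN j n y ww'.
rewrite -lee_fin in h; apply: le_trans h _.
by rewrite EFinD leeD2r//; apply: ereal_sup_ubound; exists y.
Qed.

Let u n (w : seq_space R) : \bar R :=
  ((Num.sqrt (n%:R / ((j n)%:R * 2 ^+ j n)))%:E
            * normalized_deviation phi j PN n w)%E.

Hypotheses (j_oo : forall M, exists N, forall n, (N <= n)%N -> (M <= j n)%N)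
  (rho_oo : forall M : R, exists N, forall n, (N <= n)%N ->
     M <= n%:R / ((j n)%:R * 2 ^+ j n)).

Let u_tail_le (w w' : seq_space R) : eventually_eq w w' ->
  (limn_esup (u ^~ w) <= limn_esup (u ^~ w'))%E.
Proof.
move=> [n1 ww'].
pose C := n1%:R * (2 * D).
have C0 : 0 <= C by rewrite mulr_ge0// mulr_ge0// ltW.
pose e n := Num.sqrt (n%:R / ((j n)%:R * 2 ^+ j n)) * (n%:R^-1 * (2 ^+ j n * C)).
apply: (@limn_esup_le_perturbation _ _ _ e).
- by move=> n; rewrite mule_ge0// ?lee_fin ?sqrtr_ge0// normalized_deviation_ge0.
- move=> n; rewrite EFinM -ge0_muleDr ?normalized_deviation_ge0//; last first.
    by rewrite lee_fin !mulr_ge0// ?invr_ge0// ltW.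
  by rewrite lee_wpmul2l ?lee_fin ?sqrtr_ge0//; exact: normalized_deviation_tail_le.
move=> d d0.
(* The perturbation [e n] equals [C / (sqrt rho * j n)] with [rho] the ratio in [rho_oo]; it is
   below [d] once [sqrt rho >= C / d] and [j n >= 1]. *)
have [N1 N1j] := j_oo 1; have [N2 N2r] := rho_oo ((C / d) ^+ 2 + 1).
exists (maxn 1 (maxn N1 N2)) => n; rewrite !geq_max => /and3P[n0 /N1j j1 /N2r].
rewrite /e; set rho := n%:R / _ => Cr.
have np : 0 < n%:R :> R by rewrite ltr0n.
have jp : 1 <= (j n)%:R :> R by rewrite ler1n.
have jp0 : 0 < (j n)%:R :> R by exact: lt_le_trans jp.
have pp : 0 < 2 ^+ j n :> R by rewrite exprn_gt0.
have rp : 0 < rho by rewrite divr_gt0// mulr_gt0.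
have -> : n%:R^-1 * (2 ^+ j n * C) = C / (rho * (j n)%:R).
  by rewrite /rho; field; rewrite !gt_eqF.
set r := Num.sqrt rho; have rp' : 0 < r by rewrite sqrtr_gt0.
have rr : rho = r * r by rewrite -expr2 sqr_sqrtr// ltW.
have -> : r * (C / (rho * (j n)%:R)) = C / (r * (j n)%:R).
  by rewrite rr; field; rewrite !gt_eqF.
rewrite ler_pdivrMr ?mulr_gt0//.
have Cdr : C / d <= r.
  rewrite -(@ler_pXn2r _ 2)// ?nnegrE ?divr_ge0 ?(ltW d0) ?(ltW rp')//.
  by rewrite sqr_sqrtr ?(ltW rp)//; apply: le_trans Cr; rewrite lerDl.
rewrite ler_pdivrMr// in Cdr; apply: le_trans Cdr _.
by rewrite mulrC ler_pM2l// ler_peMr// ltW.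
Qed.

Lemma normalized_limsup_cst (C0 : R) :
  {ae PN, forall w, (limn_esup (u ^~ w) <= C0%:E)%E} ->
  exists2 C : R, 0 <= C <= C0 & {ae PN, forall w, limn_esup (u ^~ w) = C%:E}.
Proof.
apply: (tail_function_ae_cst hPN).
- apply: measurable_fun_limn_esup => n; apply: measurable_funeM.
  exact: measurable_normalized_deviation.
- move=> w w' [n nw]; apply/eqP; rewrite eq_le !u_tail_le//.
    by exists n => i /nw.
  by exists n.
- move=> w; rewrite limn_esup_lim; apply: lime_ge; first exact: is_cvg_esups.
  apply: nearW => n; apply: (@le_trans _ _ (u n w)).
    by rewrite mule_ge0// ?lee_fin ?sqrtr_ge0// normalized_deviation_ge0.
  by apply: ereal_sup_ubound; exists n => /=.
Qed.

End limit.

(** * Borel-Cantelli along dyadic blocks *)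

Lemma nneseries_telescope_lty (R : realType) (f : nat -> \bar R) (K : R) :
  (forall k, (0 <= f k)%E) ->
  (forall k, (f k <= (K / (k.+1%:R * k.+2%:R))%:E)%E) ->
  (\sum_(0 <= k <oo) f k < +oo)%E.
Proof.
move=> f0 fK.
have K0 : 0 <= K.
  have := le_trans (f0 0%N) (fK 0%N); rewrite lee_fin.
  by rewrite pmulr_lge0// invr_gt0.
apply: (@le_lt_trans _ _ K%:E); last exact: ltry.
apply: (@lime_le _ _ _ R K%:E (fun n => \sum_(0 <= k < n) f k)%E).
  by apply: is_cvg_nneseries => k _ _.
apply: nearW => n; apply: (@le_trans _ _ (K * (1 - n.+1%:R^-1))%:E).
  elim: n => [|n IH]; first by rewrite big_nil invr1 subrr mulr0.
  rewrite big_nat_recr//=; apply: le_trans (leeD IH (fK n)) _.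
  rewrite -EFinD lee_fin -mulrDr ler_wpM2l// le_eqVlt; apply/orP; left.
  rewrite -[n.+2%:R]natr1 -[n.+1%:R]natr1; set x : R := n%:R.
  have x0 : 0 <= x by rewrite ler0n.
  by apply/eqP; field; apply/andP; split; apply: lt0r_neq0; lra.
by rewrite lee_fin ler_piMr// lerBlDr lerDl invr_ge0.
Qed.

Lemma Borel_Cantelli_eventually d (T : measurableType d) (R : realType)
    (P : probability T R) (E : nat -> set T) (K : R) N :
  (forall k, measurable (E k)) ->
  (forall k, (N <= k)%N -> (P (E k) <= (K / (k.+1%:R * k.+2%:R))%:E)%E) ->
  {ae P, forall w, exists k0, forall k, (k0 <= k)%N -> ~ E k w}.
Proof.
move=> mE EK.
(* With this larger constant the bound exceeds 1 for [k < N], where nothing is known about [E k]. *)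
pose K' := Num.max K (N.+1%:R * N.+2%:R).
have : P (lim_sup_set E) = 0%E.
  apply: lim_sup_set_cvg0 => //; apply: (@nneseries_telescope_lty _ _ K') => // k.
  have k0 : (0 : R) < k.+1%:R * k.+2%:R by rewrite mulr_gt0.
  have [Nk|kN] := leqP N k.
    apply: le_trans (EK k Nk) _; rewrite lee_fin ler_pM2r ?invr_gt0//.
    by rewrite le_max lexx.
  apply: (@le_trans _ _ 1%E); first exact: probability_le1.
  rewrite lee_fin ler_pdivlMr// mul1r le_max; apply/orP; right.
  by rewrite ler_pM// ler_nat; lia.
move=> E0; apply: (@negligibleS _ _ _ _ (lim_sup_set E)); last first.
  apply/negligibleP => //; apply: bigcap_measurable => // k _.
  by apply: bigcup_measurable.
move=> w /= /forallNP h n _; have /existsNP[k /not_implyP[nk /contrapT Ek]] := h n.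
by exists k.
Qed.

Lemma expR_neg_le (R : realType) (x y : R) : 1 < y -> 2 * ln y <= x ->
  expR (- x) <= y ^- 2.
Proof.
move=> y1 yx; have y0 : 0 < y by exact: lt_trans y1.
have -> : y ^- 2 = expR (- (2 * ln y)).
  by rewrite expRN expRM_natl lnK.
by rewrite ler_expR lerN2.
Qed.

Definition int_enum (n : nat) : int := if odd n then Negz n./2 else Posz n./2.

Lemma int_enum_inj : injective int_enum.
Proof.
move=> a b; rewrite /int_enum.
have := odd_double_half b; have := odd_double_half a.
by case: (odd a); case: (odd b) => // ha hb [ab]; rewrite -[LHS]ha -[RHS]hb ab.
Qed.

Lemma int_enum_surj (i : int) : exists n, int_enum n = i.
Proof.
case: i => n.
  by exists n.*2; rewrite /int_enum odd_double doubleK.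
by exists n.*2.+1; rewrite /int_enum /= odd_double /= uphalf_double.
Qed.

Section blocks.
Context (R : realType) (phi : R -> R) (B1 B2 : R) (m : nat).
Hypotheses (hphi : father_wavelet phi)
  (phi0 : forall x, ~ (B1 < x <= B2) -> phi x = 0)
  (Bm : B2 - B1 + 1 <= m%:R).
Variables (D : R).
Hypotheses (D0 : 0 < D) (sD : forall x, sum_sq_translates phi x <= D ^+ 2).
Variables (P : probability (measurableTypeR R) R)
  (PN : probability (seq_space R) R) (p0 : R -> R) (c : R).
Hypotheses (hPN : is_product_measure P PN) (dP : has_density P p0)
  (p0c : forall x, p0 x <= c) (c0 : 0 < c).

(* The rate [l] for which [N l^2 (c / 2^J) = J]; the threshold [t] is then chosen
   so that [l t = 4 J]. *)
Definition level_rate (N J : nat) : R :=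
  Num.sqrt ((J%:R * 2 ^+ J) / (N%:R * c)).

Definition level_threshold (N J : nat) : R := 4 * J%:R / level_rate N J.

Definition level_event (N J : nat) (a : 'I_m -> R) : set (seq_space R) :=
  \bigcup_k walk_exceeds (@centered _ (measurableTypeR R) R P
    (scaled_wavelet_sum phi (2 ^+ J) a (int_enum k))) N 0 (level_threshold N J).

Lemma measurable_level_event N J a : measurable (level_event N J a).
Proof.
apply: bigcupT_measurable => k; apply: measurable_walk_exceeds.
by have [] := bounded_measurable_centered hphi phi0 Bm sD P (2 ^+ J) (int_enum k) a.
Qed.

(** The lower bound on [N * c] is the square of the condition [l * (2 * D) <= 3^-1]. The factor
    [J * 2 ^ J] is absorbed because both [J] and [2 ^ J] are at most [expR J]. *)
Lemma level_event_le (N J : nat) (a : 'I_m -> R) :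
  (0 < N)%N -> (0 < J)%N -> 36 * D ^+ 2 * (J%:R * 2 ^+ J) <= N%:R * c ->
  \sum_l a l ^+ 2 <= 1 ->
  (PN (level_event N J a) <=
    (2 * m%:R * D ^+ 2 / c * expR (- J%:R))%:E)%E.
Proof.
move=> N0 J0 NJ a1.
have N0' : 0 < N%:R :> R by rewrite ltr0n.
have J0' : 1 <= J%:R :> R by rewrite ler1n.
have p2 : 0 < 2 ^+ J :> R by rewrite exprn_gt0.
have JJ : 0 < J%:R * 2 ^+ J :> R by rewrite mulr_gt0// (lt_le_trans ltr01).
set l := level_rate N J.
have q0 : 0 < (J%:R * 2 ^+ J) / (N%:R * c) by rewrite divr_gt0// mulr_gt0.
have l0 : 0 < l by rewrite sqrtr_gt0.
have ll : l ^+ 2 = (J%:R * 2 ^+ J) / (N%:R * c) by rewrite sqr_sqrtr// ltW.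
have lD : l * (2 * D) <= 3^-1.
  rewrite -(@ler_pXn2r _ 2)// ?nnegrE ?invr_ge0 ?mulr_ge0 ?(ltW l0) ?(ltW D0)//.
  rewrite exprMn ll mulrAC ler_pdivrMr ?mulr_gt0//.
  have -> : J%:R * 2 ^+ J * (2 * D) ^+ 2 =
      36 * D ^+ 2 * (J%:R * 2 ^+ J) / 9 by field.
  by rewrite ler_pdivrMr//; apply: le_trans NJ _; lra.
have lt : l * level_threshold N J = 4 * J%:R.
  by rewrite /level_threshold mulrCA mulfV ?mulr1// gt_eqF.
have lt4 : 4 <= l * level_threshold N J by rewrite lt; lra.
have NlE : N%:R * l ^+ 2 = (J%:R * 2 ^+ J) / c.
  by rewrite ll; field; rewrite !gt_eqF.
have NcE : N%:R * l ^+ 2 * (c / 2 ^+ J) = J%:R.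
  by rewrite NlE; field; rewrite !gt_eqF.
apply: le_trans (window_tail_bound hphi phi0 Bm (ltW D0) sD hPN dP p0c p2 N
  a1 int_enum_inj l0 lD lt4) _.
rewrite lee_fin lt NcE NlE.
set E := expR J%:R.
have E0 : 0 < E by rewrite expR_gt0.
have JE : J%:R <= E by apply: le_trans (expR_ge1Dx _); lra.
have PE : 2 ^+ J <= E.
  rewrite /E -[J%:R]mulr1 expRM_natl lerXn2r ?nnegrE ?expR_ge0//.
  by apply: le_trans (expR_ge1Dx _); lra.
have -> : expR (- (4 * J%:R)) = E ^- 4 by rewrite expRN expRM_natl.
rewrite expRN -/E.
have -> : 2 * E ^- 4 * (J%:R * 2 ^+ J / c) * E * (m%:R * D ^+ 2) =
    (2 * m%:R * D ^+ 2 / c * E^-1) * ((J%:R * 2 ^+ J) / E ^+ 2).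
  by field; rewrite !gt_eqF.
rewrite ler_piMr//.
  by rewrite !mulr_ge0 ?invr_ge0 ?(ltW c0) ?(ltW D0) ?(ltW E0).
rewrite ler_pdivrMr ?exprn_gt0// mul1r expr2.
by apply: ler_pM => //; exact: ltW.
Qed.

Variables (j : nat -> nat).
Hypotheses (j_oo : forall M, exists N, forall n, (N <= n)%N -> (M <= j n)%N)
  (rho_oo : forall M : R, exists N, forall n, (N <= n)%N ->
     M <= n%:R / ((j n)%:R * 2 ^+ j n))
  (loglog_oo : forall M : R, exists N, forall n, (N <= n)%N ->
     M <= (j n)%:R / ln (ln n%:R)).

(** For [n = 2 ^ k], the inequality [j n >= 2 ln (ln n)] turns [expR (- j n)] into at most
    [(k ln 2) ^ -2], which is summable. The shift [d] accounts for the levels that occur later in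
    the block. *)
Lemma block_eventually (d : nat) (a : 'I_m -> R) : \sum_l a l ^+ 2 <= 1 ->
  {ae PN, forall w, exists k0, forall k, (k0 <= k)%N ->
    ~ level_event (2 ^ k.+1) (j (2 ^ k) + d) a w}.
Proof.
move=> a1.
(* Passing from level [j n] to [j n + d] multiplies [j n * 2 ^ (j n)] by at most [d.+1 * 2 ^ d]. *)
pose A : R := 36 * D ^+ 2 / c * d.+1%:R * 2 ^+ d.
have [N1 hN1] := j_oo 1.
have [N2 hN2] := rho_oo A.
have [N3 hN3] := loglog_oo 2.
have ln2 : 0 < ln 2 :> R by rewrite ln_gt0// ltr1n.
(* From here on [k * ln 2 > e], so [ln (ln n)] exceeds 1 and may be multiplied out. *)
pose N4 := (Num.truncn (expR 1 / ln 2 : R)).+1.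
(* The 6 comes from [(k + 1) (k + 2) <= 6 k ^ 2] for [k >= 1]. *)
pose K : R := 2 * m%:R * D ^+ 2 / c * (6 / ln 2 ^+ 2).
have K0 : 0 <= 2 * m%:R * D ^+ 2 / c.
  by rewrite !mulr_ge0 ?invr_ge0 ?(ltW c0) ?(ltW D0).
apply: (@Borel_Cantelli_eventually _ _ _ _ _ K
  (maxn 1 (maxn (maxn N1 N2) (maxn N3 N4)))).
  by move=> k; exact: measurable_level_event.
move=> k; rewrite !geq_max => /and3P[k1 /andP[kN1 kN2] /andP[kN3 kN4]].
have k2 : (k <= 2 ^ k)%N by apply: ltnW; exact: ltn_expl.
have j1 := hN1 _ (leq_trans kN1 k2).
have rhoA := hN2 _ (leq_trans kN2 k2).
have jln := hN3 _ (leq_trans kN3 k2).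
set n := (2 ^ k)%N in j1 rhoA jln *.
have n0 : (0 < n)%N by rewrite expn_gt0.
have jp : 1 <= (j n)%:R :> R by rewrite ler1n.
have jp0 : 0 < (j n)%:R :> R by exact: lt_le_trans jp.
have p2 x : 0 < 2 ^+ x :> R by rewrite exprn_gt0.
have rd : 36 * D ^+ 2 * ((j n + d)%:R * 2 ^+ (j n + d)) <= (2 ^ k.+1)%:R * c.
  have : A * ((j n)%:R * 2 ^+ j n) <= n%:R by rewrite -ler_pdivlMr// mulr_gt0.
  move=> h.
  have h2 : (j n + d)%:R <= (j n)%:R * d.+1%:R :> R.
    by rewrite -natrM ler_nat mulnS leq_add2l leq_pmull.
  rewrite expnS -/n natrM exprD.
  apply: (@le_trans _ _ (c * (A * ((j n)%:R * 2 ^+ j n)))); last first.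
    apply: le_trans (ler_wpM2l (ltW c0) h) _.
    rewrite mulrC ler_pM2r// ler_peMl ?ler0n// ler1n//.
  have -> : c * (A * ((j n)%:R * 2 ^+ j n)) =
      36 * D ^+ 2 * ((j n)%:R * d.+1%:R * (2 ^+ j n * 2 ^+ d)).
    by rewrite /A; field; rewrite gt_eqF.
  apply: ler_wpM2l; first by rewrite mulr_ge0 ?sqr_ge0.
  by apply: ler_wpM2r => //; rewrite mulr_ge0 ?(ltW (p2 _)).
have N0 : (0 < 2 ^ k.+1)%N by rewrite expn_gt0.
have jd0 : (0 < j n + d)%N by rewrite addn_gt0 j1.
apply: le_trans (level_event_le N0 jd0 rd a1) _.
rewrite lee_fin /K -[leRHS]mulrA; apply: ler_wpM2l => //.
have lnn : ln n%:R = k%:R * ln 2 :> R by rewrite natrX lnXn// mulr_natl.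
have kln : expR 1 < k%:R * ln 2 :> R.
  rewrite -ltr_pdivrMr//; have := truncn_itv (_ : 0 <= expR 1 / ln 2 :> R).
  move=> /(_ (divr_ge0 (expR_ge0 _) (ltW ln2)))/andP[_ h].
  by apply: lt_le_trans h _; rewrite ler_nat.
have lnln1 : 1 < ln (ln n%:R) :> R.
  rewrite lnn -[X in X < _](expRK 1) ltr_ln ?posrE ?expR_gt0//.
  exact: lt_trans (expR_gt0 _) kln.
have jn2 : 2 * ln (k%:R * ln 2) <= (j n + d)%:R :> R.
  rewrite lnn in jln lnln1.
  move: jln; rewrite ler_pdivlMr ?(lt_trans ltr01)// => /le_trans; apply.
  by rewrite ler_nat leq_addr.
have k1' : 1 <= k%:R :> R by rewrite ler1n.
apply: le_trans (expR_neg_le _ jn2) _.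
  apply: le_lt_trans kln; rewrite -[leLHS]expR0 ler_expR; exact: ler01.
have -> : 6 / ln 2 ^+ 2 / (k.+1%:R * k.+2%:R) =
    6 / (k.+1%:R * k.+2%:R) / ln 2 ^+ 2 :> R.
  by rewrite mulrAC.
rewrite exprMn invfM ler_pM2r ?invr_gt0 ?exprn_gt0//.
rewrite ler_pdivlMr ?mulr_gt0// mulrC ler_pdivrMr ?exprn_gt0 ?(lt_le_trans ltr01)//.
rewrite -[k.+2%:R]natr1 -[k.+1%:R]natr1; move: k1'; set x : R := k%:R => k1'.
by nra.
Qed.

End blocks.

(** * The almost sure bound *)

Section upper_bound.
Context (R : realType) (phi : R -> R) (B1 B2 : R) (m : nat).
Hypotheses (hphi : father_wavelet phi)
  (phi0 : forall x, ~ (B1 < x <= B2) -> phi x = 0)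
  (Bm : B2 - B1 + 1 <= m%:R).
Variables (D : R).
Hypotheses (D0 : 0 < D) (sD : forall x, sum_sq_translates phi x <= D ^+ 2)
  (s_gt0 : forall x, 0 < sum_sq_translates phi x).
Variables (P : probability (measurableTypeR R) R)
  (PN : probability (seq_space R) R) (p0 : R -> R) (c : R).
Hypotheses (hPN : is_product_measure P PN) (dP : has_density P p0)
  (p0c : forall x, p0 x <= c) (c0 : 0 < c).
Variables (j : nat -> nat) (T n0 : nat).
Hypotheses (j_nd : nondecreasing_seq j)
  (j_oo : forall M, exists N, forall n, (N <= n)%N -> (M <= j n)%N)
  (rho_oo : forall M : R, exists N, forall n, (N <= n)%N ->
     M <= n%:R / ((j n)%:R * 2 ^+ j n))
  (loglog_oo : forall M : R, exists N, forall n, (N <= n)%N ->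
     M <= (j n)%:R / ln (ln n%:R))
  (j_double : forall n, (n0 <= n)%N -> (j (2 * n)%N <= j n + T)%N).

(** The threshold increases with [N], and at [N = 2 n] both sides agree. *)
Lemma level_threshold_normalized (N n J : nat) :
  (0 < n)%N -> (0 < J)%N -> (0 < N <= 2 * n)%N ->
  Num.sqrt (n%:R / (J%:R * 2 ^+ J)) *
    (n%:R^-1 * (2 ^+ J * (2 * level_threshold c N J))) <= 8 * Num.sqrt (2 * c).
Proof.
move=> n_gt0 J_gt0 /andP[N_gt0 Nn].
have np : 0 < n%:R :> R by rewrite ltr0n.
have Np : 0 < N%:R :> R by rewrite ltr0n.
have Jp : 0 < J%:R :> R by rewrite ltr0n.
have pp : 0 < 2 ^+ J :> R by rewrite exprn_gt0.
have xp : 0 < J%:R * 2 ^+ J :> R by rewrite mulr_gt0.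
have Nn' : N%:R <= 2 * n%:R :> R by rewrite -natrM ler_nat.
pose a := Num.sqrt (n%:R : R); pose b := Num.sqrt (J%:R * 2 ^+ J : R).
set e := Num.sqrt (2 * c).
have ap : 0 < a by rewrite sqrtr_gt0.
have bp : 0 < b by rewrite sqrtr_gt0.
have ep : 0 < e by rewrite sqrtr_gt0 mulr_gt0.
have aE : n%:R = a ^+ 2 by rewrite sqr_sqrtr// ltW.
have bE : J%:R * 2 ^+ J = b ^+ 2 by rewrite sqr_sqrtr// ltW.
have -> : Num.sqrt (n%:R / (J%:R * 2 ^+ J)) = a / b.
  by rewrite sqrtrM ?(ltW np)// sqrtrV// ltW.
have lr : b / (a * e) <= level_rate c N J.
  have -> : b / (a * e) = Num.sqrt ((J%:R * 2 ^+ J) / (n%:R * (2 * c))).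
    rewrite [RHS]sqrtrM ?(ltW xp)// sqrtrV; last first.
      by rewrite !mulr_ge0 ?(ltW c0).
    by rewrite [X in _ = _ / X]sqrtrM ?ler0n.
  rewrite ler_wsqrtr// ler_pM2l// lef_pV2 ?posrE ?mulr_gt0//.
  by rewrite mulrA ler_pM2r// mulrC.
have -> : n%:R^-1 * (2 ^+ J * (2 * level_threshold c N J)) =
    8 * (b ^+ 2 / a ^+ 2) / level_rate c N J.
  by rewrite /level_threshold -bE -aE; ring.
apply: (@le_trans _ _ (a / b * (8 * (b ^+ 2 / a ^+ 2) / (b / (a * e))))).
  apply: ler_wpM2l; first by rewrite divr_ge0 ?(ltW ap) ?(ltW bp).
  apply: ler_wpM2l; first by rewrite mulr_ge0// divr_ge0// sqr_ge0.
  rewrite lef_pV2// posrE ?sqrtr_gt0 ?divr_gt0 ?mulr_gt0//.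
rewrite le_eqVlt; apply/orP; left; apply/eqP.
by field; rewrite !gt_eqF.
Qed.

(** Inside a block the level takes one of the [T.+1] values [j (2 ^ k) + d]. With finitely many
    pairs of a shift and a grid point, one random rank works for all of them. *)
Lemma limsup_deviation_le :
  {ae PN, forall w,
       (limn_esup (fun n : nat =>
         ((Num.sqrt (n%:R / ((j n)%:R * 2 ^+ j n)))%:E
            * normalized_deviation phi j PN n w)%E)
       <= (8 * Num.sqrt (2 * c))%:E)%E}.
Proof.
pose G := {ffun 'I_m -> bool * 'I_(2 * m).+1}.
pose good (w : seq_space R) (x : nat * G) := \sum_l grid_point R x.2 l ^+ 2 <= 1 ->
  exists k0, forall k, (k0 <= k)%N ->
    ~ level_event phi P c (2 ^ k.+1) (j (2 ^ k) + x.1) (grid_point R x.2) w.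
(* Pairs are coded by [nat] to intersect countably many almost sure events; numbers that code no
   pair carry the trivial condition. *)
have : {ae PN, forall w, forall i : nat,
    if @unpickle (nat * G)%type i is Some x then good w x else True}.
  apply: ae_foralln => i; case: unpickle => [x|]; last exact: aeW.
  have [x1|x1] := pselect (\sum_l grid_point R x.2 l ^+ 2 <= 1); last first.
    by apply: aeW => w /x1.
  have := block_eventually hphi phi0 Bm D0 sD hPN dP p0c c0 j_oo rho_oo loglog_oo
    x.1 x1.
  by apply: filterS => w h _.
apply: filterS => w good_w.
have [k0 hk0] : {k0 : nat * G -> nat & forall x,
    \sum_l grid_point R x.2 l ^+ 2 <= 1 -> forall k, (k0 x <= k)%N ->
    ~ level_event phi P c (2 ^ k.+1) (j (2 ^ k) + x.1) (grid_point R x.2) w}.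
  apply: (@choice _ _ (fun x k0 => \sum_l grid_point R x.2 l ^+ 2 <= 1 ->
    forall k, (k0 <= k)%N -> ~ level_event phi P c (2 ^ k.+1) (j (2 ^ k) + x.1)
      (grid_point R x.2) w)) => x.
  have := good_w (pickle x); rewrite pickleK => gx.
  have [/gx[k0 hk0]|x1] := pselect (\sum_l grid_point R x.2 l ^+ 2 <= 1).
    by exists k0 => _.
  by exists 0%N => /x1.
pose K := (\max_(d < T.+1) \max_(g : G) k0 (d : nat, g))%N.
have [N1 hN1] := j_oo 1.
apply: (@limn_esup_le _ _ _ (2 ^ (maxn K (maxn n0 N1)))) => n nK.
have n_gt0 : (0 < n)%N by rewrite (leq_trans _ nK)// expn_gt0.
pose k := trunc_log 2 n.
have /andP[kn nk] := trunc_log_bounds (isT : (1 < 2)%N) n_gt0.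
rewrite -/k in kn nk.
have : (maxn K (maxn n0 N1) <= k)%N by exact: trunc_log_max.
rewrite !geq_max => /and3P[Kk n0k N1k].
have k2 : (k <= 2 ^ k)%N by apply: ltnW; exact: ltn_expl.
have J0 : (0 < j n)%N by apply: hN1; rewrite (leq_trans N1k)// (leq_trans k2).
have jle : (j (2 ^ k)%N <= j n)%N by have := j_nd kn.
have jn : (j n <= j (2 ^ k)%N + T)%N.
  apply: leq_trans (j_double (leq_trans n0k k2)).
  by rewrite -expnS; exact: j_nd (ltnW nk).
pose d := (j n - j (2 ^ k)%N)%N.
have dE : (j (2 ^ k)%N + d)%N = j n by rewrite /d subnKC.
have dT : (d < T.+1)%N by rewrite ltnS /d leq_subLR.
have walk_le i (g : G) : \sum_l grid_point R g l ^+ 2 <= 1 ->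
    walk (@centered _ (measurableTypeR R) R P
       (scaled_wavelet_sum phi (2 ^+ j n) (grid_point R g) i)) n w <=
    level_threshold c (2 ^ k.+1) (j n).
  move=> g1; rewrite leNgt; apply/negP => h.
  have Kx : (k0 (d, g) <= k)%N.
    apply: leq_trans Kk; rewrite /K.
    apply: leq_trans (leq_bigmax (Ordinal dT)).
    exact: (@leq_bigmax _ (fun g => k0 (d, g))).
  apply: (hk0 (d, g) g1 k Kx); rewrite /= dE.
  have [i' ii'] := int_enum_surj i.
  exists i' => //; rewrite ii'; exists n; first exact: ltnW.
  by rewrite add0r.
apply: (@le_trans _ _ ((Num.sqrt (n%:R / ((j n)%:R * 2 ^+ j n)))%:E *
  (n%:R^-1 * (2 ^+ j n * (2 * level_threshold c (2 ^ k.+1) (j n))))%:E)%E).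
  rewrite lee_wpmul2l ?lee_fin ?sqrtr_ge0//.
  rewrite /normalized_deviation; apply: ge_ereal_sup => _ [y _ <-].
  rewrite lee_fin.
  exact: (deviation_le hphi phi0 Bm (ltW D0) sD s_gt0 hPN y walk_le).
rewrite -EFinM lee_fin level_threshold_normalized//.
by rewrite expn_gt0 /= expnS leq_mul2l kn.
Qed.

End upper_bound.

(** Otherwise the density would have total mass 0. Positivity matters since [level_rate] divides by
    [c]. *)
Lemma density_bound_gt0 (R : realType) (P : probability (measurableTypeR R) R)
    (p0 : R -> R) (c : R) :
  has_density P p0 -> (forall x, p0 x <= c) -> 0 < c.
Proof.
move=> [_ p00 dP] p0c; rewrite ltNge; apply/negP => c0.
have := probability_setT P; rewrite [LHS]dP//.
rewrite integral0_eq; first by move=> /eqP; rewrite eq_sym onee_eq0.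
move=> x _; congr EFin; apply/eqP; rewrite eq_le p00 andbT.
exact: le_trans (p0c x) c0.
Qed.

Theorem theorem1 (R : realType) :
  exists M : R -> R -> R -> R -> R -> R,
  forall (phi : R -> R) (p B1 B2 : R)
    (P : probability (measurableTypeR R) R) (p0 : R -> R)
    (PN : probability (seq_space R) R)
    (Phi : R -> R) (D1 D2 A v : R)
    (j : nat -> nat) (tau : R) (n0 : nat),
  (* the wavelet *)
  father_wavelet phi ->
  1 <= p -> bounded_p_variation p phi ->
  B1 < B2 -> (forall x, ~ (B1 < x <= B2) -> phi x = 0) ->
  (* the law P and its infinite power *)
  has_density P p0 -> bounded_fun p0 ->
  is_product_measure P PN ->
  (* the majorant Phi *)
  (forall x, 0 <= Phi x) -> bounded_fun Phi ->
  compact (closure [set x | Phi x != 0]) ->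
  (forall x, Phi (- x) = Phi x) ->
  (forall y x, `|wavelet_kernel phi y x| <= Phi (y - x)) ->
  (* the constants D1, D2 *)
  0 < D1 -> D1 <= D2 ->
  (forall y,
     [/\ ((D1 ^+ 2)%:E <=
            \int[@lebesgue_measure R]_u (wavelet_kernel phi y u ^+ 2)%:E)%E,
         (\int[@lebesgue_measure R]_u (wavelet_kernel phi y u ^+ 2)%:E
            = (sum_sq_translates phi y)%:E)%E &
         sum_sq_translates phi y <= D2 ^+ 2]) ->
  (* the constants A, v *)
  0 < A -> 0 < v ->
  (forall eps, 0 < eps -> eps < A ->
     (ereal_sup (range (fun Q : probability (measurableTypeR R) R =>
                          covering_number (wavelet_class phi) Q eps))
        <= ((A / eps) `^ v)%:E)%E) ->
  (* the resolution levels j_n *)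
  nondecreasing_seq j ->
  j n @[n --> \oo] --> \oo ->
  (n%:R / ((j n)%:R * 2 ^+ j n) : R) @[n --> \oo] --> +oo ->
  ((j n)%:R / ln (ln n%:R) : R) @[n --> \oo] --> +oo ->
  1 <= tau ->
  (forall n, (n0 <= n)%N -> (j (2 * n)%N)%:R - (j n)%:R <= tau) ->
  exists C : R,
    C ^+ 2 <= M D1 D2 (supnorm Phi) A v ^+ 2 * 2 `^ tau * supnorm p0 /\
    {ae PN, forall w,
       limn_esup (fun n : nat =>
         ((Num.sqrt (n%:R / ((j n)%:R * 2 ^+ j n)))%:E
            * normalized_deviation phi j PN n w)%E) = C%:E}.
Proof.
exists (fun _ _ _ _ _ => 12).
move=> phi p B1 B2 P p0 PN Phi D1 D2 A v j tau n0 hphi _ _ _ phi0 dP bp0 hPN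
  _ _ _ _ _ D1_gt0 D12 hD _ _ _ j_nd /cvgnyPge j_oo /cvgryPge rho_oo
  /cvgryPge loglog_oo tau1 j_tau.
have D2_gt0 : 0 < D2 by exact: lt_le_trans D12.
have sD y : sum_sq_translates phi y <= D2 ^+ 2 by have [] := hD y.
have s_gt0 y : 0 < sum_sq_translates phi y.
  have [h1 h2 _] := hD y; rewrite h2 lee_fin in h1.
  by apply: lt_le_trans h1; rewrite exprn_gt0.
have p0c x : p0 x <= supnorm p0.
  apply: le_trans (ler_norm _) _; apply: ub_le_sup; last by exists x.
  have [b [_ hb]] := bp0.
  by exists (b + 1) => _ [y _ <-]; apply: hb => //; rewrite ltrDl.
have c0 := density_bound_gt0 dP p0c.
pose m := (Num.truncn (B2 - B1 + 1)).+1.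
have Bm : B2 - B1 + 1 <= m%:R by apply: ltW; exact: truncnS_gt.
have j_oo' M : exists N, forall n, (N <= n)%N -> (M <= j n)%N.
  by have [N _ hN] := j_oo M; exists N.
have rho_oo' (M : R) : exists N, forall n, (N <= n)%N ->
    M <= n%:R / ((j n)%:R * 2 ^+ j n).
  by have [N _ hN] := rho_oo M; exists N.
have loglog_oo' (M : R) : exists N, forall n, (N <= n)%N ->
    M <= (j n)%:R / ln (ln n%:R).
  by have [N _ hN] := loglog_oo M; exists N.
have j_double n : (n0 <= n)%N -> (j (2 * n)%N <= j n + (Num.truncn tau).+1)%N.
  move=> /j_tau h; rewrite -(ler_nat R) natrD -lerBlDl.
  by apply: le_trans h _; apply: ltW; exact: truncnS_gt.
have := limsup_deviation_le hphi phi0 Bm D2_gt0 sD s_gt0 hPN dP p0c c0 j_nd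
  j_oo' rho_oo' loglog_oo' j_double.
move=> /(normalized_limsup_cst hphi phi0 Bm D2_gt0 sD s_gt0 hPN j_oo' rho_oo').
move=> [C /andP[C0 CC] aeC]; exists C; split; last exact: aeC.
apply: (@le_trans _ _ ((8 * Num.sqrt (2 * supnorm p0)) ^+ 2)).
  by rewrite lerXn2r ?nnegrE// (le_trans C0).
rewrite exprMn sqr_sqrtr; last by rewrite mulr_ge0// ltW.
have : 1 <= 2 `^ tau :> R.
  by rewrite -[leLHS](powRr0 2) ler_powR ?ler1n// (le_trans ler01).
have := c0; set c := supnorm p0; set q := 2 `^ tau => cp q1.
have : c <= q * c by rewrite ler_peMl// ltW.
by rewrite -mulrA; lra.
Qed.
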